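(* Let $t$ be a positive integer and let $\lambda=(\lambda_1,\lambda_2,\dots,\lambda_r)$ be a partition with $\lambda_1=\lambda_2$ (so $r\ge2$). If $\lambda_1\le t$, then $$\Delta_t^\lambda\simeq \Delta_t^{\lambda'}\vee\Sigma\left(\Delta_t^{\lambda''}\right),$$ where $\lambda'=(\lambda_2,\lambda_3,\dots,\lambda_r)$ and $\lambda''=(\min\{\lambda_1-1,\lambda_2\},\min\{\lambda_1-1,\lambda_3\},\dots,\min\{\lambda_1-1,\lambda_r\})$.
   Context: A partition $\lambda=(\lambda_1,\dots,\lambda_r)$ is a finite sequence of integers $\lambda_1\ge\lambda_2\ge\dots\ge\lambda_r\ge1$, identified with its Young diagram: a top- and left-justified array of boxes with $\lambda_j$ boxes in row $j$, row $1$ being the top row. For a positive integer $t$, fill the box in row $j$ and column $i$ ($1\le j\le r$, $1\le i\le\lambda_j$) with the integer $(r-j)t+i$. The $t$-Young complex $\Delta_t^\lambda$ is the simplicial complex whose facets are all sets $\{a_1,\dots,a_{\lambda_1}\}$ with $a_1<\dots<a_{\lambda_1}$ and such that $a_j$ is an entry of the $j$-th column of $\lambda$ for every $1\le j\le\lambda_1$. For $\mu=(0,\dots,0)$ one sets $\Delta_t^\mu=\emptyset$ (the complex without vertices). $\Sigma(\Delta)$ is the suspension of $\Delta$ (the join of $\Delta$ with two disjoint points), with the convention $\Sigma(\emptyset)=S^0$; $\vee$ is the wedge sum and $\simeq$ is homotopy equivalence. Simplicial complexes are identified with their geometric realizations. *)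

(* Defs.v *)
From HB Require Import structures.
From mathcomp Require Import all_boot all_order all_algebra finmap.
From mathcomp Require Import mathcomp_extra boolp classical_sets functions.
From mathcomp Require Import cardinality set_interval reals topology normedtype.
From mathcomp Require Import wedge_sigT.

Set Implicit Arguments.
Unset Strict Implicit.
Unset Printing Implicit Defensive.

Import Order.TTheory GRing.Theory Num.Theory.
Import numFieldNormedType.Exports.
Local Open Scope fset_scope.
Local Open Scope classical_set_scope.
Local Open Scope ring_scope.

Definition homotopic (R : realType) (X Y : topologicalType) (f g : X -> Y) :
    Prop :=
  exists H : R * X -> Y,
    [/\ {within `[0, 1]%classic `*` [set: X], continuous H},
        forall x, H (0, x) = f x & forall x, H (1, x) = g x].

Definition homotopy_equivalent (R : realType) (X Y : topologicalType) : Prop :=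
  exists (f : X -> Y) (g : Y -> X),
    [/\ continuous f, continuous g,
        homotopic R (g \o f) idfun & homotopic R (f \o g) idfun].

Definition wedge2 (X Y : topologicalType) (x : X) (y : Y) : topologicalType :=
  wedge (X := fun b : bool => if b then X else Y)
    (fun b => if b return (if b then X else Y : topologicalType) then x else y).

(** The empty face always belongs to the
    complex, so that "the complex without vertices" is the one whose only face
    is [fset0].  Elements of [V] that do not lie in a face are not vertices. *)

Record fscomplex (V : choiceType) := FSComplex {
  faces : set {fset V};
  finite_faces : finite_set faces;
  fset0_face : faces fset0;
  subset_face : forall s s' : {fset V}, faces s -> (s' `<=` s)%fset -> faces s'
}.

(** Barycentric coordinates.  As the complex is finite, the topology induced by
    the product topology of [V -> R] is the usual (coherent) one. *)
Definition realization_set (R : realType) (V : choiceType) (K : fscomplex V) :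
    set (prod_topology (fun _ : V => R : topologicalType)) :=
  [set x | (forall v, 0 <= x v) /\
           exists2 s : {fset V}, faces K s &
             (forall v, v \notin s -> x v = 0) /\ \sum_(v <- s) x v = 1].

Definition realization (R : realType) (V : choiceType) (K : fscomplex V) :
    topologicalType :=
  set_type (@realization_set R V K).

(** The join lives on the disjoint union [V + W] of the vertex types. *)

Definition join_face (V W : choiceType) (s : {fset V}) (s' : {fset W}) :
    {fset V + W} :=
  ([fset inl v | v in s] `|` [fset inr w | w in s'])%fset.

Section Join.
Variables (V W : choiceType) (K : fscomplex V) (L : fscomplex W).

Definition join_faces : set {fset V + W} :=
  [set s | exists s1 s2, [/\ faces K s1, faces L s2 & s = join_face s1 s2]].

Lemma finite_join_faces : finite_set join_faces.
Proof.
have fin : finite_set ((fun p : {fset V} * {fset W} => join_face p.1 p.2) @`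
    (faces K `*` faces L)).
  by apply: finite_image; apply: finite_setX; exact: finite_faces.
apply: sub_finite_set fin => s [s1 [s2 [h1 h2 ->]]].
by exists (s1, s2).
Qed.

Lemma fset0_join_face : join_faces fset0.
Proof.
exists fset0, fset0; split; [exact: fset0_face|exact: fset0_face|].
apply/fsetP => x; rewrite in_fsetU in_fset0; apply/esym/negbTE.
by rewrite negb_or; apply/andP; split; apply/imfsetP => -[].
Qed.

Lemma subset_join_face (s s' : {fset V + W}) :
  join_faces s -> (s' `<=` s)%fset -> join_faces s'.
Proof.
move=> [s1 [s2 [h1 h2 ->]]] sub.
exists [fset v in s1 | inl v \in s'], [fset w in s2 | inr w \in s'].
split.
- by apply: subset_face h1 _; apply/fsubsetP => v; rewrite !inE => /andP[].
- by apply: subset_face h2 _; apply/fsubsetP => v; rewrite !inE => /andP[].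
apply/fsetP => x; apply/idP/idP => [xs'|].
  have := fsubsetP sub _ xs'; rewrite !in_fsetU => /orP[] /imfsetP[y /= ys xE].
    by apply/orP; left; apply/imfsetP; exists y; rewrite //= !inE ys -xE.
  by apply/orP; right; apply/imfsetP; exists y; rewrite //= !inE ys -xE.
by rewrite in_fsetU => /orP[] /imfsetP[y] /=; rewrite !inE => /andP[_ ?] ->.
Qed.

Definition join : fscomplex (V + W)%type :=
  FSComplex finite_join_faces fset0_join_face subset_join_face.

End Join.

Definition two_points_faces : set {fset bool} :=
  [set s | s = fset0 \/ exists b, s = [fset b]].

Lemma finite_two_points_faces : finite_set two_points_faces.
Proof. exact: finite_finset. Qed.

Lemma subset_two_points_face (s s' : {fset bool}) :
  two_points_faces s -> (s' `<=` s)%fset -> two_points_faces s'.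
Proof.
move=> [->|[b ->]]; first by rewrite fsubset0 => /eqP; left.
by rewrite fsubset1 => /orP[] /eqP ->; [right; exists b|left].
Qed.

Definition two_points : fscomplex bool :=
  FSComplex finite_two_points_faces (or_introl erefl) subset_two_points_face.

Definition suspension (V : choiceType) (K : fscomplex V) :
    fscomplex (V + bool)%type :=
  join K two_points.

(** Rows and columns are numbered from [1];
    row [j] of [lam] has [nth 0 lam j.-1] boxes. *)

Definition is_partition (lam : seq nat) : Prop :=
  sorted geq lam /\ all (leq 1) lam.

Definition row_length (lam : seq nat) (j : nat) : nat := nth 0%N lam j.-1.

Definition box_entry (t : nat) (lam : seq nat) (j i : nat) : nat :=
  ((size lam - j) * t + i)%N.

Definition column_entry (t : nat) (lam : seq nat) (i a : nat) : Prop :=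
  exists j : nat, [/\ (1 <= j <= size lam)%N, (1 <= i <= row_length lam j)%N &
                      a = box_entry t lam j i].

(** [a] lists [a_1 < ... < a_{lam_1}], so that [a_i] is [nth 0 a i.-1]. *)
Definition young_facet (t : nat) (lam a : seq nat) : Prop :=
  [/\ size a = row_length lam 1, sorted ltn a &
      forall i : nat, (1 <= i <= row_length lam 1)%N ->
        column_entry t lam i (nth 0%N a i.-1)].

(** All facets have [lam_1] elements, hence they are exactly the maximal faces
    of the complex they generate. *)
Definition young_faces (t : nat) (lam : seq nat) : set {fset nat} :=
  [set s | exists2 a, young_facet t lam a & {subset s <= a}].

Section Young.
Variables (t : nat) (lam : seq nat).

Lemma young_facet_ub a x : young_facet t lam a -> x \in a ->
  (x < (size lam * t + row_length lam 1).+1)%N.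
Proof.
move=> [sa _ col] /(nthP 0%N)[i ilt <-].
have /col[j [_ _ ->]] : (1 <= i.+1 <= row_length lam 1)%N by rewrite /= -sa.
by rewrite ltnS leq_add ?leq_mul2r ?leq_subr ?orbT// -sa.
Qed.

Lemma finite_young_faces : finite_set (young_faces t lam).
Proof.
pose N := (size lam * t + row_length lam 1).+1.
apply: (@sub_finite_set _ _ [set` fpowerset [fset x in iota 0 N]]); last first.
  exact: finite_fset.
move=> s [a ha sub]; rewrite /= fpowersetE; apply/fsubsetP => x /sub xa.
have xN : x \in iota 0 N by rewrite mem_iota leq0n (young_facet_ub ha xa).
by apply/imfsetP; exists x.
Qed.

Lemma first_row_facet :
  young_facet t lam [seq box_entry t lam 1 i | i <- iota 1 (row_length lam 1)].
Proof.
split; first by rewrite size_map size_iota.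
  rewrite sorted_map; apply: (sub_sorted _ (iota_ltn_sorted _ _)) => x y /=.
  by rewrite /box_entry ltn_add2l.
move=> i /andP[i0 ile]; exists 1%N; split.
- by case: (lam) ile => [|//]; case: i i0.
- by rewrite i0.
rewrite (nth_map 0%N) ?size_iota ?prednK//.
by rewrite nth_iota ?prednK// add1n prednK.
Qed.

Lemma fset0_young_face : young_faces t lam fset0.
Proof. by eexists; [exact: first_row_facet|]. Qed.

Lemma subset_young_face (s s' : {fset nat}) :
  young_faces t lam s -> (s' `<=` s)%fset -> young_faces t lam s'.
Proof.
move=> [a ha sub] /fsubsetP sub'; exists a => // x /sub'.
exact: sub.
Qed.

Definition young_complex : fscomplex nat :=
  FSComplex finite_young_faces fset0_young_face subset_young_face.

End Young.

(** Base points exist: the realizations of a nonempty Young complex and of any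
    suspension are inhabited. *)

Lemma realization_inhabited (R : realType) (V : choiceType) (K : fscomplex V)
    (v : V) :
  faces K [fset v]%fset -> inhabited (realization R K).
Proof.
move=> Kv; apply: inhabits; exists (fun w => (w == v)%:R).
rewrite inE; split=> [w|]; first exact: ler0n.
exists [fset v]%fset => //; split=> [w|].
  by rewrite inE => /negbTE ->.
by rewrite big_seq_fset1 eqxx.
Qed.

Lemma young_complex_inhabited (R : realType) (t : nat) (lam : seq nat) :
  (0 < row_length lam 1)%N -> inhabited (realization R (young_complex t lam)).
Proof.
move=> lam0; apply: (@realization_inhabited _ _ _ (box_entry t lam 1 1)).
eexists; first exact: first_row_facet.
move=> x; rewrite inE => /eqP ->; apply/mapP; exists 1%N => //.
by rewrite mem_iota leqnn add1n ltnS.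
Qed.

Lemma suspension_inhabited (R : realType) (V : choiceType) (K : fscomplex V) :
  inhabited (realization R (suspension K)).
Proof.
apply: (@realization_inhabited _ _ _ (inr true)).
exists fset0, [fset true]%fset; split.
- exact: fset0_face.
- by right; exists true.
apply/fsetP => x; rewrite /join_face in_fsetU in_fset1.
apply/eqP/orP => [->|[] /imfsetP[y]//=].
  by right; apply/imfsetP; exists true => //; rewrite in_fset1.
by rewrite in_fset1 => /eqP -> ->.
Qed.

(* Main.v *)
Require Import Defs.
From mathcomp Require Import all_boot all_order all_algebra finmap.
From mathcomp Require Import boolp classical_sets functions.
From mathcomp Require Import cardinality reals topology normedtype.
From mathcomp Require Import wedge_sigT.
From mathcomp Require Import lra zify.

Set Implicit Arguments.
Unset Strict Implicit.
Unset Printing Implicit Defensive.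

Import Order.TTheory GRing.Theory Num.Theory.
Import numFieldNormedType.Exports.
Local Open Scope classical_set_scope.
Local Open Scope ring_scope.

(** Since [lam_1 <= t], a facet is a choice of one box in each column such that
    the rows weakly go up from left to right.  Let [v] and [w] be the boxes of
    the last column in rows 1 and 2.  Sending every box of row 1 to [v] is a
    deformation of [Delta^lam] onto [A u (v * L)], where [A = Delta^lam'] and
    [L = Delta^lam'' = A n (v * L)].  As [w * L] is contained in [A], the
    inclusion of [L] in [A] is homotopic to a constant map.  The homotopy type of
    a space with a cone on [L] attached only depends on the homotopy class of the
    attaching map, and attaching the cone along a constant map gives
    [A \/ Sigma L]. *)

(** * Continuity on subsets *)

(** Entries are numbered from the bottom row up, so deleting the top row or the last column keeps
    the labels of the other boxes: [Delta^lam'] and [Delta^lam''] are literal subcomplexes of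
    [Delta^lam]. The bound [lam_1 <= t] makes an entry determine its box, so row 1 shares no label
    with a lower row. The equality [lam_1 = lam_2] puts [w] in column [lam_1] and allows each box of
    row 1 to be lowered to row 2. Complexes are finite, hence realizations are compact Hausdorff and
    an adjunction space is recognised by its underlying set. Homotopy invariance of an attachment is
    proved once, for a closed set with a collar, and used both for the base of a cone and for a
    single point. The second use comes from the base points, which are arbitrary. Contracting [L] to
    [p] settles [p]; but crushing the base of the cone gives a pole as base point of the suspension,
    and it has to be moved to [q] along a path. If [L] has no vertex there may be no such path, and
    the pole is chosen to be [q]. *)

Section WithinContinuity.
Context {T U : topologicalType}.
Implicit Type A : set T.

Lemma within_continuous_cst A (a : U) : {within A, continuous (fun _ : T => a)}.
Proof. by apply: continuous_subspaceT => x; exact: cvg_cst. Qed.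

Lemma within_continuous_eq A (f g : T -> U) :
  (forall x, A x -> f x = g x) ->
  {within A, continuous f} -> {within A, continuous g}.
Proof.
move=> fg; apply: subspace_eq_continuous => x; rewrite inE; exact: fg.
Qed.

Lemma within_continuous_comp_in {W : topologicalType} A (B : set U)
    (f : T -> U) (g : U -> W) :
  {within A, continuous f} -> {within B, continuous g} ->
  (forall x, A x -> B (f x)) -> {within A, continuous (g \o f)}.
Proof.
move=> /subspace_continuousP cf /subspace_continuousP cg AB.
apply/subspace_continuousP => x Ax.
apply: cvg_trans (cg _ (AB _ Ax)) => P /= gP.
have := cf _ Ax _ gP; rewrite /within/= !nbhs_simpl /=.
rewrite /within /nbhs /= => h.
by near do by move=> *; apply: (near h _) => //; exact: AB.
Unshelve. all: by end_near. Qed.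

Lemma within_continuous_pair {W : topologicalType} A (f : T -> U) (g : T -> W) :
  {within A, continuous f} -> {within A, continuous g} ->
  {within A, continuous (fun x => (f x, g x))}.
Proof.
move=> cf cg x; exact: (cvg_pair (cf x) (cg x)).
Qed.

Lemma within_continuousU A B (f g : T -> U) : closed A -> closed B ->
  {within A, continuous f} -> {within B, continuous g} ->
  (forall x, A x -> B x -> f x = g x) -> forall h : T -> U,
  (forall x, A x -> h x = f x) -> (forall x, B x -> ~ A x -> h x = g x) ->
  {within A `|` B, continuous h}.
Proof.
move=> cA cB cf cg fg h hf hg; apply: withinU_continuous => //.
  by apply: within_continuous_eq cf => x Ax; rewrite hf.
apply: within_continuous_eq cg => x Bx; have [Ax|nAx] := pselect (A x).
  by rewrite hf// fg.
by rewrite hg.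
Qed.

End WithinContinuity.

Section RealValued.
Context {R : realType} {T : topologicalType}.
Implicit Types f g : T -> R.

Lemma cts_cst (a : R) : continuous (fun _ : T => a).
Proof. by move=> x; exact: cvg_cst. Qed.

Lemma ctsD f g : continuous f -> continuous g -> continuous (fun x => f x + g x).
Proof. by move=> cf cg x; exact: (continuousD (cf x) (cg x)). Qed.

Lemma ctsB f g : continuous f -> continuous g -> continuous (fun x => f x - g x).
Proof. by move=> cf cg x; exact: (continuousB (cf x) (cg x)). Qed.

Lemma ctsM f g : continuous f -> continuous g -> continuous (fun x => f x * g x).
Proof. by move=> cf cg x; exact: (continuousM (cf x) (cg x)). Qed.

Lemma ctsMl (a : R) f : continuous f -> continuous (fun x => a * f x).
Proof. by move=> cf; apply: ctsM => //; exact: cts_cst. Qed.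

Lemma cts_max f g : continuous f -> continuous g ->
  continuous (fun x => Num.max (f x) (g x)).
Proof. by move=> cf cg x; exact: (continuous_max (cf x) (cg x)). Qed.

Lemma cts_min f g : continuous f -> continuous g ->
  continuous (fun x => Num.min (f x) (g x)).
Proof. by move=> cf cg x; exact: (continuous_min (cf x) (cg x)). Qed.

Lemma cts_sum (I : Type) (s : seq I) (P : pred I) (F : I -> T -> R) :
  (forall i, continuous (F i)) -> continuous (fun x => \sum_(i <- s | P i) F i x).
Proof.
move=> cF; elim: s => [|i s IH].
  by under [X in continuous X]eq_fun do rewrite big_nil; exact: cts_cst.
under [X in continuous X]eq_fun do rewrite big_cons.
by case: (P i) => //; exact: ctsD.
Qed.

Lemma ctsV f : (forall x, f x != 0) -> continuous f ->
  continuous (fun x => (f x)^-1).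
Proof. by move=> f0 cf x; exact: (continuousV (f0 x) (cf x)). Qed.

Lemma within_ctsV (A : set T) f : (forall x, A x -> f x != 0) ->
  {within A, continuous f} -> {within A, continuous (fun x => (f x)^-1)}.
Proof.
move=> f0 /subspace_continuousP cf; apply/subspace_continuousP => x Ax.
exact: (cvgV (f0 _ Ax) (cf _ Ax)).
Qed.

End RealValued.

Lemma closed_setX {T U : topologicalType} (A : set T) (B : set U) :
  closed A -> closed B -> closed (A `*` B).
Proof.
move=> cA cB; have -> : A `*` B = fst @^-1` A `&` snd @^-1` B by [].
by apply: closedI; [apply: (continuous_closedP _).1 => // z; exact: cvg_fst|
  apply: (continuous_closedP _).1 => // z; exact: cvg_snd].
Qed.

Lemma closed_le_fun {R : realType} {T : topologicalType} (f g : T -> R) :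
  continuous f -> continuous g -> closed [set x | f x <= g x].
Proof.
move=> cf cg.
have -> : [set x | f x <= g x] = (fun x => g x - f x) @^-1` [set y | 0 <= y].
  by apply/seteqP; split=> x /=; rewrite subr_ge0.
by apply: (continuous_closedP _).1; [exact: ctsB|exact: closed_ge].
Qed.

Lemma closed_eq_fun {R : realType} {T : topologicalType} (f g : T -> R) :
  continuous f -> continuous g -> closed [set x | f x = g x].
Proof.
move=> cf cg; have -> : [set x | f x = g x] =
    [set x | f x <= g x] `&` [set x | g x <= f x].
  apply/seteqP; split=> x /= => [->//|[fg gf]].
  by apply/eqP; rewrite eq_le fg gf.
by apply: closedI; exact: closed_le_fun.
Qed.

(** * Homotopies *)

Section Homotopy.
Context {R : realType}.

(** Attaching maps only matter on the base of a cone; they are kept total, with irrelevant values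
    elsewhere, and compared on [B] alone. *)
Definition homotopic_on {X Y : topologicalType} (B : set X) (f g : X -> Y) :=
  exists H : R * X -> Y,
    [/\ {within `[0, 1]%classic `*` B, continuous H},
        forall x, B x -> H (0, x) = f x & forall x, B x -> H (1, x) = g x].

Lemma homotopic_onT {X Y : topologicalType} (f g : X -> Y) :
  homotopic_on setT f g -> homotopic R f g.
Proof. by move=> [H [cH H0 H1]]; exists H; split=> // x; [exact: H0|exact: H1]. Qed.

Lemma continuous_fst_snd {X : topologicalType} (a : R -> R) :
  continuous a -> continuous (fun z : R * X => (a z.1, z.2)).
Proof.
move=> ca z.
have h1 : {for z, continuous (fun z : R * X => a z.1)}.
  by apply: (@continuous_comp _ _ _ fst a); [exact: cvg_fst|exact: ca].
have h2 : {for z, continuous (fun z : R * X => z.2)} by exact: cvg_snd.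
exact: (cvg_pair h1 h2).
Qed.

Lemma homotopic_on_sym {X Y : topologicalType} (B : set X) (f g : X -> Y) :
  homotopic_on B f g -> homotopic_on B g f.
Proof.
move=> [H [cH H0 H1]]; exists (H \o (fun z => (1 - z.1, z.2))); split.
- apply: within_continuous_comp_in cH _.
    apply: continuous_subspaceT; apply: (@continuous_fst_snd _ (fun t => 1 - t)).
    by apply: ctsB; [exact: cts_cst|move=> ?; exact: cvg_id].
  move=> [t x] [/=]; rewrite !in_itv/= => t01 Bx; split=> //=.
  by rewrite ?in_itv/=; lra.
- by move=> x Bx /=; rewrite subr0 H1.
- by move=> x Bx /=; rewrite subrr H0.
Qed.

Lemma homotopic_on_trans {X Y : topologicalType} (B : set X) (f g h : X -> Y) :
  closed B -> homotopic_on B f g -> homotopic_on B g h -> homotopic_on B f h.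
Proof.
move=> cB [H [cH H0 H1]] [H' [cH' H'0 H'1]].
exists (fun z => if z.1 <= 2^-1 then H (2 * z.1, z.2) else H' (2 * z.1 - 1, z.2)).
have -> : `[0:R, 1]%classic `*` B =
    `[0:R, 2^-1]%classic `*` B `|` `[2^-1, 1]%classic `*` B.
  apply/seteqP; split=> -[t x] /=; rewrite !in_itv/=.
    by move=> [t01 Bx]; have [?|?] := leP t (2^-1); [left|right]; split=> //; lra.
  by move=> [] [t01 Bx]; split=> //; lra.
split.
- apply: (@within_continuousU _ _ _ _ (H \o (fun z => (2 * z.1, z.2)))
    (H' \o (fun z => (2 * z.1 - 1, z.2)))).
  + by apply: closed_setX => //; exact: interval_closed.
  + by apply: closed_setX => //; exact: interval_closed.
  + apply: within_continuous_comp_in cH _.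
      apply: continuous_subspaceT; apply: (@continuous_fst_snd _ (fun t => 2 * t)).
      by apply: ctsMl; move=> ?; exact: cvg_id.
    move=> [t x] [/=]; rewrite !in_itv/= => t01 Bx; split=> //=.
    by rewrite ?in_itv/=; lra.
  + apply: within_continuous_comp_in cH' _.
      apply: continuous_subspaceT.
      apply: (@continuous_fst_snd _ (fun t => 2 * t - 1)).
      apply: ctsB; last exact: cts_cst.
      by apply: ctsMl; move=> ?; exact: cvg_id.
    move=> [t x] [/=]; rewrite !in_itv/= => t01 Bx; split=> //=.
    by rewrite ?in_itv/=; lra.
  + move=> [t x] [/=]; rewrite !in_itv/= => t1 Bx [t2 _].
    have -> : 2 * t - 1 = 0 by lra.
    have -> : 2 * t = 1 by lra.
    by rewrite H1// H'0.
  + by move=> [t x] [/=]; rewrite in_itv/= => /andP[_ ->].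
  + move=> [t x] [/=]; rewrite !in_itv/= => /andP[t1 t2] Bx.
    case: ifPn => // t3 []; split=> //.
    by rewrite ?in_itv/=; lra.
- by move=> x Bx /=; rewrite ifT ?mulr0 ?H0//; lra.
- by move=> x Bx /=; rewrite ifF ?mulr1; [rewrite (_ : 2 - 1 = 1) ?H'1//; lra|
    apply/negbTE; rewrite -ltNge; lra].
Qed.

Lemma homotopic_comp {X Y Z W : topologicalType} (u : X -> Y) (f g : Y -> Z)
    (v : Z -> W) : continuous u -> continuous v ->
  homotopic R f g -> homotopic R (v \o f \o u) (v \o g \o u).
Proof.
move=> cu cv [H [cH H0 H1]].
exists (v \o H \o (fun z => (z.1, u z.2))); split; last 2 first.
- by move=> x /=; rewrite H0.
- by move=> x /=; rewrite H1.
have cvH := within_continuous_comp_in cH (continuous_subspaceT (A := setT) cv)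
  (fun _ _ => I).
apply: (within_continuous_comp_in _ cvH); last by move=> z [].
apply: within_continuous_pair; apply: continuous_subspaceT => z.
  exact: cvg_fst.
by apply: (@continuous_comp _ _ _ snd u); [exact: cvg_snd|exact: cu].
Qed.

Lemma homotopic_trans {X Y : topologicalType} (f g h : X -> Y) :
  homotopic R f g -> homotopic R g h -> homotopic R f h.
Proof.
move=> [H [cH H0 H1]] [H' [cH' H'0 H'1]]; apply: homotopic_onT.
apply: (@homotopic_on_trans _ _ _ _ g); first exact: closedT.
  by exists H; split=> // x _; rewrite ?H0 ?H1.
by exists H'; split=> // x _; rewrite ?H'0 ?H'1.
Qed.

Lemma homotopy_equivalent_trans (X Y Z : topologicalType) :
  homotopy_equivalent R X Y -> homotopy_equivalent R Y Z ->
  homotopy_equivalent R X Z.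
Proof.
move=> [f [g [cf cg gf fg]]] [f' [g' [cf' cg' gf' fg']]].
exists (f' \o f), (g \o g'); split.
- by move=> x; apply: continuous_comp; [exact: cf|exact: cf'].
- by move=> x; apply: continuous_comp; [exact: cg'|exact: cg].
- exact: homotopic_trans (homotopic_comp cf cg gf') gf.
- exact: homotopic_trans (homotopic_comp cg' cf' fg) fg'.
Qed.

End Homotopy.

(** * Gluing compact spaces *)

Lemma hausdorff_prod (T U : topologicalType) :
  hausdorff_space T -> hausdorff_space U -> hausdorff_space (T * U)%type.
Proof.
move=> hT hU [t u] [t' u'] clu; congr (_, _).
  apply: hT => A B At Bt.
  have fA : nbhs (t, u) (fst @^-1` A) by exact: (@cvg_fst _ _ (nbhs t) (nbhs u)).
  have fB : nbhs (t', u') (fst @^-1` B).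
    exact: (@cvg_fst _ _ (nbhs t') (nbhs u')).
  by have [z [? ?]] := clu _ _ fA fB; exists z.1.
apply: hU => A B Au Bu.
have fA : nbhs (t, u) (snd @^-1` A) by exact: (@cvg_snd _ _ (nbhs t) (nbhs u)).
have fB : nbhs (t', u') (snd @^-1` B).
  exact: (@cvg_snd _ _ (nbhs t') (nbhs u')).
by have [z [? ?]] := clu _ _ fA fB; exists z.2.
Qed.

(** A continuous map from a compact set to a Hausdorff space is closed, hence a quotient map onto
    its image. *)
Lemma within_continuous_compact_image {U V T : topologicalType} (f : U -> V)
    (h : V -> T) (K : set U) : hausdorff_space V -> compact K -> continuous f ->
  {within K, continuous (h \o f)} -> {within f @` K, continuous h}.
Proof.
move=> hV cK cf /continuous_closedP chf; apply/continuous_closedP => D /chf.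
move=> /closed_subspaceP[W cW WK]; apply/closed_subspaceP.
exists (f @` (W `&` K)).
  apply: compact_closed => //; apply: continuous_compact.
    exact: continuous_subspaceT.
  by rewrite setIC; exact: compact_closedI.
rewrite WK; apply/seteqP; split=> [y [[x [Dx Kx] xy] _]|y [Dy [x Kx xy]]].
  by rewrite -xy; split=> //; exists x.
by rewrite -xy in Dy *; split; exists x.
Qed.

Section Gluing.
Context {R : realType} {X Z : topologicalType}.

(** [P] is the pushout of [X <- B -> Z] along [phi], and remains so after taking
    the product with the unit interval; [phi] is irrelevant outside of [B]. *)
Definition glued (B : set Z) (phi : Z -> X) (P : topologicalType)
    (i : X -> P) (j : Z -> P) : Prop :=
  [/\ [/\ continuous i, continuous j & forall z, B z -> j z = i (phi z)],
      forall p, (exists x, i x = p) \/ (exists z, j z = p) &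
      forall (T : topologicalType) (a : R * X -> T) (b : R * Z -> T),
        {within `[0, 1]%classic `*` setT, continuous a} ->
        {within `[0, 1]%classic `*` setT, continuous b} ->
        (forall t z, t \in `[0, 1] -> B z -> b (t, z) = a (t, phi z)) ->
        exists H : R * P -> T,
          [/\ {within `[0, 1]%classic `*` setT, continuous H},
              forall t x, t \in `[0, 1] -> H (t, i x) = a (t, x) &
              forall t z, t \in `[0, 1] -> H (t, j z) = b (t, z)]].

(** The assumptions on [i] and [j] describe the pushout of sets. The topology follows: the images of
    the two compact cylinders are closed, they cover the product of [P] with the interval, and
    continuity on each can be tested on the cylinder. *)
Lemma glued_compact (B : set Z) (phi : Z -> X) (P : topologicalType)
    (i : X -> P) (j : Z -> P) :
  compact [set: X] -> compact [set: Z] -> hausdorff_space P ->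
  continuous i -> continuous j -> injective i ->
  (forall z, B z -> j z = i (phi z)) ->
  (forall x z, i x = j z -> B z) ->
  (forall z z', ~ B z -> j z = j z' -> z = z') ->
  (forall p, (exists x, i x = p) \/ (exists z, j z = p)) ->
  glued B phi i j.
Proof.
move=> kX kZ hP ci cj inji ij ijB injj surj; split=> // T a b ca cb ab.
pose H (tp : R * P) : T := match pselect (exists x, i x = tp.2) with
  | left e => a (tp.1, projT1 (cid e))
  | right ne => b (tp.1, projT1 (cid
      match surj tp.2 with
      | or_introl e => False_ind _ (ne e)
      | or_intror e => e
      end))
  end.
have Hi t x : H (t, i x) = a (t, x).
  rewrite /H; case: pselect => [e|[]]; last by exists x.
  by case: cid => x' /= /inji ->.
have Hj t z : t \in `[0, 1] -> H (t, j z) = b (t, z).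
  move=> t01; rewrite /H; case: pselect => [e|ne].
    case: cid => x /= ix; have Bz := ijB _ _ ix.
    by rewrite ab//; congr (a (_, _)); apply: inji; rewrite ix ij.
  case: cid => z' /= jz; congr (b (_, _)); apply/esym/injj => // Bz.
  by apply: ne; exists (phi z) => /=; rewrite ij.
exists H; split=> //.
pose I' := `[0:R, 1]%classic.
pose fi (z : R * X) : R * P := (z.1, i z.2).
pose fj (z : R * Z) : R * P := (z.1, j z.2).
have cfi : continuous fi.
  move=> z; have h1 : {for z, continuous (fun z : R * X => z.1)} by exact: cvg_fst.
  have h2 : {for z, continuous (fun z : R * X => i z.2)}.
    by apply: (@continuous_comp _ _ _ snd i); [exact: cvg_snd|exact: ci].
  exact: (cvg_pair h1 h2).
have cfj : continuous fj.
  move=> z; have h1 : {for z, continuous (fun z : R * Z => z.1)} by exact: cvg_fst.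
  have h2 : {for z, continuous (fun z : R * Z => j z.2)}.
    by apply: (@continuous_comp _ _ _ snd j); [exact: cvg_snd|exact: cj].
  exact: (cvg_pair h1 h2).
have kIX : compact (I' `*` [set: X]).
  by apply: compact_setX => //; exact: segment_compact.
have kIZ : compact (I' `*` [set: Z]).
  by apply: compact_setX => //; exact: segment_compact.
have hRP : hausdorff_space (R * P)%type.
  by apply: hausdorff_prod => //; exact: Rhausdorff.
have -> : I' `*` setT = fi @` (I' `*` setT) `|` fj @` (I' `*` setT).
  apply/seteqP; split=> [[t p] [/= It _]|].
    have [[x <-]|[z <-]] := surj p; [left|right].
      by exists (t, x).
    by exists (t, z).
  by move=> tp [] [[t x] [/= It _] <-].
have kc (A : set (R * P)) : compact A -> closed A by exact: compact_closed.
apply: withinU_continuous.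
- by apply: kc; apply: continuous_compact => //; exact: continuous_subspaceT cfi.
- by apply: kc; apply: continuous_compact => //; exact: continuous_subspaceT cfj.
- apply: within_continuous_compact_image => //.
  by apply: within_continuous_eq ca => -[t x] _ /=; rewrite Hi.
- apply: within_continuous_compact_image => //.
  by apply: within_continuous_eq cb => -[t x] [/= It _]; rewrite Hj.
Qed.

End Gluing.

(** * Homotopic gluing maps *)

Section Collar.
Context {R : realType} {X Z : topologicalType}.

(** [m] measures the depth in a collar of the closed set [m = 1], and [e (k, z)]
    moves [z] along its collar line from depth [m z] to depth [k * m z]. *)
Record collar (m : Z -> R) (e : R * Z -> Z) : Prop := Collar {
  collar_continuous : continuous m;
  collar_itv : forall z, 0 <= m z <= 1;
  collar_move_continuous :
    {within [set kz : R * Z | 1 <= kz.1 /\ kz.1 * m kz.2 <= 1], continuous e};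
  collar_move1 : forall z, e (1, z) = z;
  collar_moveE : forall k z, 1 <= k -> k * m z <= 1 -> m (e (k, z)) = k * m z;
  collar_move_move : forall k l z, 1 <= k -> 1 <= l -> l * k * m z <= 1 ->
    e (l, e (k, z)) = e (l * k, z) }.

Variables (m : Z -> R) (e : R * Z -> Z).
Hypothesis me : collar m e.

Let B := [set z | m z = 1].

Let m1 z : m z <= 1. Proof. by have /andP[] := collar_itv me z. Qed.

Let m0 z : 0 <= m z. Proof. by have /andP[] := collar_itv me z. Qed.

(** Stretching by the inverse depth follows the collar line to its end, so this point serves as the
    projection of [z] to [B]. *)
Let e_boundary z : 0 < m z -> B (e ((m z)^-1, z)).
Proof.
move=> mz0; rewrite /B/= (collar_moveE me) ?mulVf ?gt_eqF//.
by rewrite invr_ge1 ?m1// unitfE gt_eqF.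
Qed.

Section Pieces.
Context {P S : topologicalType}.
Variables (phi : Z -> X) (i : X -> P) (j : Z -> P).
Variables (ci : continuous i) (cj : continuous j).
Hypothesis ij : forall z, B z -> j z = i (phi z).

(** Common pattern of the maps and homotopies below: up to depth [alpha] the collar line is
    stretched to its full length, beyond it the end of the line follows [Psi] at time [theta]. At
    depth [alpha] both formulas give the end of the line, seen through [j] or through [i], because
    [Psi] is [phi] there. *)
Lemma collar_pieces_continuous (Psi : R * Z -> X) (C : set S) (alpha theta : S -> R)
    (zeta : S -> Z) :
  {within `[0, 1]%classic `*` B, continuous Psi} -> closed C ->
  continuous alpha -> continuous theta -> continuous zeta ->
  (forall s, C s -> 0 < alpha s <= 1) ->
  (forall s, C s -> alpha s <= m (zeta s) -> 0 <= theta s <= 1) ->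
  (forall s z, C s -> m (zeta s) = alpha s -> B z -> Psi (theta s, z) = phi z) ->
  {within C, continuous (fun s => if m (zeta s) <= alpha s
     then j (e ((alpha s)^-1, zeta s))
     else i (Psi (theta s, e ((m (zeta s))^-1, zeta s))))}.
Proof.
move=> cPsi cC calpha ctheta czeta alpha01 theta01 Psiphi.
have cm : continuous (fun s => m (zeta s)).
  by move=> s; apply: continuous_comp; [exact: czeta|exact: collar_continuous me _].
pose C1 := C `&` [set s | m (zeta s) <= alpha s].
pose C2 := C `&` [set s | alpha s <= m (zeta s)].
have -> : C = C1 `|` C2.
  apply/seteqP; split=> [s Cs|s [][]//].
  by have [?|/ltW ?] := leP (m (zeta s)) (alpha s); [left|right].
have C1D s : C1 s -> 1 <= (alpha s)^-1 /\ (alpha s)^-1 * m (zeta s) <= 1.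
  move=> [Cs /= mz]; have /andP[a0 a1] := alpha01 _ Cs.
  by rewrite invr_ge1 ?unitfE ?gt_eqF// a1 ler_pdivrMl// mulr1.
have C2D s : C2 s -> 1 <= (m (zeta s))^-1 /\ (m (zeta s))^-1 * m (zeta s) <= 1.
  move=> [Cs /= mz]; have /andP[a0 a1] := alpha01 _ Cs.
  have mz0 := lt_le_trans a0 mz.
  by rewrite invr_ge1 ?unitfE ?gt_eqF// m1 mulVf// gt_eqF.
have C2m s : C2 s -> 0 < m (zeta s).
  by move=> [Cs /= mz]; have /andP[a0 a1] := alpha01 _ Cs; exact: lt_le_trans mz.
apply: (@within_continuousU _ _ _ _ (fun s => j (e ((alpha s)^-1, zeta s)))
  (fun s => i (Psi (theta s, e ((m (zeta s))^-1, zeta s))))).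
- by apply: closedI => //; exact: closed_le_fun.
- by apply: closedI => //; exact: closed_le_fun.
- have h1 : {within C1, continuous (fun s => ((alpha s)^-1, zeta s))}.
    apply: within_continuous_pair; last exact: continuous_subspaceT.
    apply: within_ctsV; last exact: continuous_subspaceT.
    by move=> s [/alpha01/andP[a0 _] _]; rewrite gt_eqF.
  have h2 := within_continuous_comp_in h1 (collar_move_continuous me) C1D.
  exact: (within_continuous_comp_in h2 (continuous_subspaceT (A := setT) cj)).
- have h1 : {within C2, continuous (fun s => ((m (zeta s))^-1, zeta s))}.
    apply: within_continuous_pair; last exact: continuous_subspaceT.
    apply: within_ctsV; last exact: continuous_subspaceT.
    by move=> s /C2m m0s; rewrite gt_eqF.
  have h2 := within_continuous_comp_in h1 (collar_move_continuous me) C2D.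
  have h3 := within_continuous_pair (continuous_subspaceT (A := C2) ctheta) h2.
  have h4 : {within C2, continuous
      (Psi \o (fun s => (theta s, (e \o (fun s => ((m (zeta s))^-1, zeta s))) s)))}.
    apply: (within_continuous_comp_in h3 cPsi) => s C2s; split=> /=.
      by rewrite in_itv/= theta01//; case: C2s.
    exact/e_boundary/C2m.
  exact: (within_continuous_comp_in h4 (continuous_subspaceT (A := setT) ci)).
- move=> s C1s C2s.
  have am : m (zeta s) = alpha s.
    by apply/eqP; rewrite eq_le C1s.2 C2s.2.
  have Be := e_boundary (C2m _ C2s).
  by rewrite Psiphi//; [rewrite -am ij|exact: C1s.1].
- by move=> s [_ /= ->].
- move=> s C2s nC1; rewrite ifN//; apply/negP => h; apply: nC1.
  by split; [exact: C2s.1|].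
Qed.

End Pieces.

(** Identity on [X]; a collar line is traversed twice as fast up to its end in
    [B], and then continued by the track of the homotopy [Psi]. *)
Definition glued_map_spec {P0 P1 : topologicalType} (Psi : R * Z -> X)
    (i0 : X -> P0) (j0 : Z -> P0) (i1 : X -> P1) (j1 : Z -> P1) (F : P0 -> P1) :=
  [/\ continuous F, forall x, F (i0 x) = i1 x &
      forall z, F (j0 z) = if m z <= 2^-1 then j1 (e (2, z))
                           else i1 (Psi (2 * m z - 1, e ((m z)^-1, z)))].

Lemma continuous_itv0 {P T : topologicalType} (H : R * P -> T) :
  {within `[0, 1]%classic `*` setT, continuous H} ->
  continuous (fun p => H (0, p)).
Proof.
move=> cH; apply/continuous_subspace_setT.
apply: (within_continuous_comp_in _ cH).
  apply: within_continuous_pair; apply: continuous_subspaceT.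
    by move=> p; exact: cvg_cst.
  by move=> p; exact: cvg_id.
by move=> p _; split=> //=; rewrite in_itv/= lexx ler01.
Qed.

(** The direction of [Psi] is forced. At depth 1/2 the stretched line ends in [P1] at the image of
    [phi1 z]; at depth 1 the value has to be the image of [phi0 z], since [j0 z = i0 (phi0 z)] and
    [X] is fixed. *)
Lemma glued_map_exists {P0 P1 : topologicalType} (phi0 phi1 : Z -> X)
    (i0 : X -> P0) (j0 : Z -> P0) (i1 : X -> P1) (j1 : Z -> P1)
    (Psi : R * Z -> X) :
  glued (R := R) B phi0 i0 j0 -> glued (R := R) B phi1 i1 j1 ->
  {within `[0, 1]%classic `*` B, continuous Psi} ->
  (forall z, B z -> Psi (0, z) = phi1 z) ->
  (forall z, B z -> Psi (1, z) = phi0 z) ->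
  exists F : P0 -> P1, glued_map_spec Psi i0 j0 i1 j1 F.
Proof.
move=> [_ _ univ] [[ci cj ij] _ _] cPsi Psi0 Psi1.
(* The factor 2 is written [(2^-1)^-1] to match [collar_pieces_continuous] with [alpha] equal to
   1/2. The universal property speaks of homotopies: [b] is constant in time, and the map is read
   off at time 0. *)
pose b (tz : R * Z) := if m tz.2 <= 2^-1 then j1 (e ((2^-1)^-1, tz.2))
                      else i1 (Psi (2 * m tz.2 - 1, e ((m tz.2)^-1, tz.2))).
have [||t z _ Bz|H [cH Hi Hj]] := univ P1 (fun tx => i1 tx.2) b.
- apply: continuous_subspaceT => z.
  by apply: (@continuous_comp _ _ _ snd i1); [exact: cvg_snd|exact: ci].
- apply: (@collar_pieces_continuous _ _ phi1 i1 j1 ci cj ij _ _ (fun=> 2^-1)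
    (fun s : R * Z => 2 * m s.2 - 1) snd) => //.
  + by apply: closed_setX; [exact: interval_closed|exact: closedT].
  + exact: cts_cst.
  + apply: ctsB; last exact: cts_cst.
    apply: ctsMl => s; apply: (@continuous_comp _ _ _ snd m); first exact: cvg_snd.
    exact: collar_continuous me _.
  + by move=> s; exact: cvg_snd.
  + by move=> s _; rewrite invr_gt0 ltr0n/=; lra.
  + by move=> s _ h; have := m1 s.2; lra.
  + move=> s z _ -> Bz; rewrite -[RHS]Psi0//; congr (Psi (_, _)); lra.
- rewrite /b/= Bz ifF ?mulr1 ?invr1 ?(collar_move1 me); last first.
    by apply/negbTE; rewrite -ltNge; lra.
  by rewrite (_ : 2 - 1 = 1); [rewrite Psi1|lra].
have I0 : (0 : R) \in `[0, 1] by rewrite in_itv/= lexx ler01.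
exists (fun p => H (0, p)); split; first exact: continuous_itv0.
  by move=> x; rewrite Hi.
by move=> z; rewrite Hj// /b/= invrK.
Qed.

Lemma glued_map_homotopy {P0 P1 : topologicalType} (phi0 : Z -> X)
    (i0 : X -> P0) (j0 : Z -> P0) (i1 : X -> P1) (j1 : Z -> P1)
    (Psi : R * Z -> X) (F : P0 -> P1) (G : P1 -> P0) :
  glued (R := R) B phi0 i0 j0 ->
  {within `[0, 1]%classic `*` B, continuous Psi} ->
  (forall z, B z -> Psi (1, z) = phi0 z) ->
  glued_map_spec Psi i0 j0 i1 j1 F ->
  glued_map_spec (fun tz => Psi (1 - tz.1, tz.2)) i1 j1 i0 j0 G ->
  homotopic R (G \o F) idfun.
Proof.
move=> [[ci cj ij] surj univ] cPsi Psi1 [cF Fi Fj] [cG Gi Gj].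
(* Along a collar line [G \o F] runs to the end of the line for [m <= 1/4], then
   backwards and forwards on the track of [Psi].  At time [t] the first part is
   [m <= alpha], and the track is only followed back to the parameter
   [min theta = t], so that nothing but the collar line remains at [t = 1]. *)
pose alpha (tz : R * Z) := (1 + 3 * tz.1) / 4.
pose theta (tz : R * Z) := Num.max (2 - 4 * m tz.2 + 3 * tz.1) (2 * m tz.2 - 1).
pose b (tz : R * Z) := if m tz.2 <= alpha tz then j0 (e ((alpha tz)^-1, tz.2))
  else i0 (Psi (theta tz, e ((m tz.2)^-1, tz.2))).
have I0 : (0 : R) \in `[0, 1] by rewrite in_itv/= lexx ler01.
have I1 : (1 : R) \in `[0, 1] by rewrite in_itv/= lexx ler01.
have cm : continuous (fun tz : R * Z => m tz.2).
  move=> s; apply: (@continuous_comp _ _ _ snd m); first exact: cvg_snd.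
  exact: collar_continuous me _.
have cfst : continuous (fun tz : R * Z => tz.1) by move=> s; exact: cvg_fst.
have [||t z It Bz|H [cH Hi Hj]] := univ P0 (fun tx => i0 tx.2) b.
- apply: continuous_subspaceT => z.
  by apply: (@continuous_comp _ _ _ snd i0); [exact: cvg_snd|exact: ci].
- apply: (@collar_pieces_continuous _ _ phi0 i0 j0 ci cj ij _ _ alpha theta snd) => //.
  + by apply: closed_setX; [exact: interval_closed|exact: closedT].
  + apply: ctsM; last exact: cts_cst.
    by apply: ctsD; [exact: cts_cst|exact: ctsMl].
  + apply: cts_max; last by apply: ctsB; [exact: ctsMl|exact: cts_cst].
    apply: ctsD; last exact: ctsMl.
    by apply: ctsB; [exact: cts_cst|exact: ctsMl].
  + by move=> s; exact: cvg_snd.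
  + by move=> [t z] [/=]; rewrite in_itv/= /alpha/= => t01 _; lra.
  + move=> [t z] [/=]; rewrite in_itv/= /alpha/theta/= => t01 _ h.
    by rewrite le_max ge_max; have := m1 z; lra.
  (* At depth [alpha] the first term of [theta] is 1 and dominates. The two terms cross at depth
     [(1 + t) / 2], with value [t]. *)
  + move=> [t z] z' [/=]; rewrite in_itv/= /alpha/theta/= => t01 _ h Bz'.
    by rewrite -[RHS]Psi1//; congr (Psi (_, _)); rewrite max_l; lra.
- move: It; rewrite in_itv/= /b/= Bz => t01; case: ifPn => h.
    have -> : alpha (t, z) = 1 by move: h; rewrite /alpha/=; lra.
    by rewrite invr1 (collar_move1 me) ij.
  rewrite invr1 (collar_move1 me) -[phi0 z]Psi1//; congr (i0 (Psi (_, _))).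
  by rewrite /theta/= Bz max_r; lra.
exists H; split=> // p.
- have [[x <-]|[z <-]] := surj p; first by rewrite Hi//= Fi Gi.
  rewrite Hj//= Fj /b /alpha /theta/= mulr0 addr0 div1r invrK.
  (* Up to depth 1/4 both maps stretch by 2; between 1/4 and 1/2 only [F] does, and [G] runs back
     along the track; above 1/2 [F] already lands in [X], which [G] fixes. *)
  have [m2|m2] := leP (m z) 2^-1; last first.
    by rewrite ifF; [rewrite Gi max_r//; lra|lra].
  have me2 : m (e (2, z)) = 2 * m z by rewrite (collar_moveE me)//; lra.
  rewrite Gj me2; have [m4|m4] := leP (m z) 4^-1.
    rewrite ifT; last lra.
    rewrite (collar_move_move me); [|lra|lra|lra].
    by rewrite (_ : 2 * 2 = 4)//; lra.
  rewrite ifF; last lra.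
  have mz0 : m z != 0 by lra.
  have mz2 : 2 * m z != 0 by lra.
  rewrite (collar_move_move me); last 3 first.
  + by lra.
  + by rewrite invr_ge1 ?unitfE; lra.
  + by rewrite -mulrA mulVf.
  rewrite max_l; last lra.
  congr (i0 (Psi (_, e (_, _)))); first by rewrite /=; lra.
  by rewrite invfM mulrAC mulVf ?mul1r ?pnatr_eq0.
- have [[x <-]|[z <-]] := surj p; first by rewrite Hi.
  rewrite Hj// /b /alpha/=.
  have -> : (1 + 3 * 1) / 4 = 1 :> R by lra.
  by rewrite m1 invr1 (collar_move1 me).
Qed.

Theorem glued_homotopy_equivalent {P0 P1 : topologicalType} (phi0 phi1 : Z -> X)
    (i0 : X -> P0) (j0 : Z -> P0) (i1 : X -> P1) (j1 : Z -> P1) :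
  glued (R := R) B phi0 i0 j0 -> glued (R := R) B phi1 i1 j1 ->
  homotopic_on (R := R) B phi0 phi1 -> homotopy_equivalent R P0 P1.
Proof.
move=> gl0 gl1 /homotopic_on_sym[Psi [cPsi Psi0 Psi1]].
have cPsi' : {within `[0, 1]%classic `*` B, continuous
    (fun tz => Psi (1 - tz.1, tz.2))}.
  apply: (within_continuous_comp_in _ cPsi).
    apply: continuous_subspaceT.
    apply: (@continuous_fst_snd _ _ (fun t => 1 - t)).
    by apply: ctsB; [exact: cts_cst|move=> ?; exact: cvg_id].
  move=> [t z] [/=]; rewrite !in_itv/= => t01 Bz; split=> //=.
  by rewrite ?in_itv/=; lra.
have Psi'0 z : B z -> Psi (1 - 0, z) = phi0 z by rewrite subr0; exact: Psi1.
have Psi'1 z : B z -> Psi (1 - 1, z) = phi1 z by rewrite subrr; exact: Psi0.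
have [F hF] := glued_map_exists gl0 gl1 cPsi Psi0 Psi1.
have [G hG] := glued_map_exists gl1 gl0 cPsi' Psi'0 Psi'1.
exists F, G; split; [by case: hF|by case: hG| |].
  exact: glued_map_homotopy gl0 cPsi Psi1 hF hG.
(* Reversing twice restores [Psi], so the same lemma with [F] and [G] exchanged yields the other
   homotopy. *)
have hF' : glued_map_spec (fun tz => Psi (1 - (1 - tz.1), tz.2)) i0 j0 i1 j1 F.
  case: hF => cF Fi Fj; split=> // z; rewrite Fj; case: ifPn => // _.
  by rewrite /= opprB addrCA subrr addr0.
exact: (glued_map_homotopy (Psi := fun tz => Psi (1 - tz.1, tz.2)) gl1 cPsi'
  Psi'1 hG hF').
Qed.

End Collar.

(** * Realizations *)

Section Simplex.
Context {R : realType} {V : choiceType}.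
Implicit Types (s : {fset V}) (x y : V -> R) (K : fscomplex V).

Definition simplex s x :=
  [/\ forall v, 0 <= x v, forall v, v \notin s -> x v = 0 & \sum_(v <- s) x v = 1].

Lemma realization_setE K : realization_set K = \bigcup_(s in faces K) simplex s.
Proof.
apply/seteqP; split=> x [].
  by move=> x0 [s Ks [xs x1]]; exists s.
by move=> s Ks [x0 xs x1]; split=> //; exists s.
Qed.

Lemma sum_supp s s' x : (forall v, v \notin s -> x v = 0) ->
  (forall v, v \notin s' -> x v = 0) -> \sum_(v <- s) x v = \sum_(v <- s') x v.
Proof.
move=> xs xs'; transitivity (\sum_(v <- (s `|` s')%fset) x v).
  by apply: big_fset_incl => [|v _]; [exact: fsubsetUl|exact: xs].
by apply/esym/big_fset_incl => [|v _]; [exact: fsubsetUr|exact: xs'].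
Qed.

Lemma simplexS s s' x : (s `<=` s')%fset -> simplex s x -> simplex s' x.
Proof.
move=> /fsubsetP ss' [x0 xs x1].
have xs' v : v \notin s' -> x v = 0.
  by move=> vs'; apply: xs; apply: contra vs'; exact: ss'.
by split=> //; rewrite -(sum_supp xs xs').
Qed.

Lemma simplex_le1 s x v : simplex s x -> x v <= 1.
Proof.
move=> [x0 xs <-]; have [vs|/xs ->] := boolP (v \in s); last by rewrite sumr_ge0.
by rewrite (big_fsetD1 v)//= lerDl sumr_ge0.
Qed.

Lemma simplex_conv s x y (t : R) : 0 <= t <= 1 -> simplex s x -> simplex s y ->
  simplex s (fun v => (1 - t) * x v + t * y v).
Proof.
move=> /andP[t0 t1] [x0 xs x1] [y0 ys y1]; split.
- by move=> v; rewrite addr_ge0 ?mulr_ge0 ?subr_ge0.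
- by move=> v vs; rewrite xs// ys// !mulr0 addr0.
- by rewrite big_split/= -!mulr_sumr x1 y1 !mulr1 subrK.
Qed.

Definition dirac_pt (v : V) : V -> R := fun u => (u == v)%:R.

Lemma simplex_dirac v s : v \in s -> simplex s (dirac_pt v).
Proof.
move=> vs; have : simplex [fset v]%fset (dirac_pt v); last first.
  by apply: simplexS; rewrite fsub1set.
split=> [u|u|]; [exact: ler0n| |].
  by rewrite inE /dirac_pt => /negbTE ->.
by rewrite big_seq_fset1 /dirac_pt eqxx.
Qed.

Lemma simplex_neq0 s x : simplex s x -> exists v, v \in s.
Proof.
move=> [_ _]; have [->|/fset0Pn//] := eqVneq s fset0.
by rewrite big_seq_fset0 => /eqP; rewrite eq_sym oner_eq0.
Qed.

(** [realization R K] unfolds to a [set_type], whose [val] is not found by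
    unification through the [topologicalType] packaging. *)
Definition coord K (x : realization R K) : V -> R :=
  set_val (x : set_type (@realization_set R V K)).

(** [x0] is the default for an [x] outside the realization. Maps are thus written as formulas on
    coordinates, justified afterwards through [coord_realpt]. *)
Definition realpt K (x0 : realization R K) (x : V -> R) : realization R K :=
  insubd (x0 : set_type (@realization_set R V K)) x.

Lemma coord_simplex K (x : realization R K) :
  exists2 s, faces K s & simplex s (coord x).
Proof.
have : @realization_set R V K (coord x) by exact: set_valP.
by rewrite realization_setE.
Qed.

Lemma coord_realpt K (x0 : realization R K) s x :
  faces K s -> simplex s x -> coord (realpt x0 x) = x.
Proof.
by move=> Ks sx; apply: insubdK; apply/mem_set; rewrite realization_setE; exists s.
Qed.

Lemma coord_surj K s x : faces K s -> simplex s x ->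
  exists p : realization R K, coord p = x.
Proof.
move=> Ks sx; have xK : x \in @realization_set R V K.
  by apply/mem_set; rewrite realization_setE; exists s.
by exists (exist _ x xK).
Qed.

Lemma coord_inj K (x y : realization R K) : coord x =1 coord y -> x = y.
Proof. by move=> xy; apply: val_inj; apply/funext. Qed.

Lemma coord_ge0 K (x : realization R K) v : 0 <= coord x v.
Proof. by have [s _ []] := coord_simplex x. Qed.

Lemma coord_le1 K (x : realization R K) v : coord x v <= 1.
Proof. by have [s _ /simplex_le1] := coord_simplex x. Qed.

End Simplex.

Lemma injective_hausdorff (T U : topologicalType) (f : T -> U) :
  injective f -> continuous f -> hausdorff_space U -> hausdorff_space T.
Proof.
move=> injf cf hU x y clxy; apply/injf/hU => A B /cf nA /cf nB.
by have [z [? ?]] := clxy _ _ nA nB; exists (f z).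
Qed.

Lemma compact_set_type (T : topologicalType) (A : set T) :
  compact A -> compact [set: set_type A].
Proof.
move=> kA; have [A0|/set0P[a Aa]] := eqVneq A set0.
  rewrite (_ : setT = set0); first exact: compact0.
  by apply/seteqP; split=> // -[x]; rewrite A0 => /[dup] /set_mem.
pose a' : set_type A := exist _ a (mem_set Aa).
rewrite (_ : setT = insubd a' @` A).
  apply: continuous_compact => //.
  apply/subspace_sigL_continuousP.
  suff -> : sigL A (insubd a' : T -> set_type A) = id by move=> ?; exact: cvg_id.
  by apply/funext => x; rewrite /sigL/= valKd.
apply/seteqP; split=> // x _; exists (val x); first exact/set_mem/valP.
by rewrite valKd.
Qed.

Lemma prod_continuous (T : topologicalType) (I : Type) (U : topologicalType)
    (f : T -> prod_topology (fun _ : I => U)) :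
  (forall i, continuous (fun t => f t i)) -> continuous f.
Proof.
move=> cf t; apply/cvg_sup => i A [_ [[W oW <-]] /= Wft WA].
apply: (filterS WA); apply: (cf i t).
exact: open_nbhs_nbhs.
Qed.

Section RealizationTopology.
Context {R : realType} {V : choiceType}.
Implicit Types (K : fscomplex V).

Lemma coord_continuous K (v : V) : continuous (fun x : realization R K => coord x v).
Proof.
have h1 : continuous
    (@coord R V K : _ -> prod_topology (fun _ : V => R : topologicalType)).
  exact: initial_continuous.
have h2 := @proj_continuous V (fun _ => R : topologicalType) v.
by move=> x; apply: (@continuous_comp _ _ _ _ _ x (h1 x) (h2 _)).
Qed.

Lemma coord_comp_continuous (T : topologicalType) K (f : T -> realization R K) v :
  continuous f -> continuous (fun t => coord (f t) v).
Proof.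
move=> cf t; apply: (@continuous_comp _ _ _ f (fun x => coord x v)); first exact: cf.
exact: coord_continuous.
Qed.

Lemma realization_continuous (T : topologicalType) K (f : T -> realization R K) :
  (forall v, continuous (fun t => coord (f t) v)) -> continuous f.
Proof. by move=> cf; apply: continuous_comp_initial; exact: prod_continuous. Qed.

Lemma realization_hausdorff K : hausdorff_space (realization R K).
Proof.
apply: (@injective_hausdorff _ _
  (@coord R V K : _ -> prod_topology (fun _ : V => R : topologicalType))).
- by move=> x y xy; apply: coord_inj => v; rewrite xy.
- exact: initial_continuous.
- by apply: hausdorff_product => v; exact: Rhausdorff.
Qed.

Lemma simplex_compact (s : {fset V}) :
  compact (simplex s : set (prod_topology (fun _ : V => R : topologicalType))).
Proof.
have kcube := @tychonoff V (fun _ => R : topologicalType) (fun _ => `[0, 1]%classic)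
  (fun _ => @segment_compact R 0 1).
apply: (subclosed_compact _ kcube); last first.
  move=> x sx v /=; rewrite in_itv/= (simplex_le1 _ sx) andbT.
  by case: sx.
have cv v := @proj_continuous V (fun _ => R : topologicalType) v.
have -> : simplex s = (\bigcap_v [set x : V -> R | 0 <= x v]) `&`
    (\bigcap_(v in [set v | v \notin s]) [set x : V -> R | x v = 0]) `&`
    [set x : V -> R | \sum_(v <- s) x v = 1].
  apply/seteqP; split=> [x [x0 xs x1]|x [[x0 xs] x1]].
    split; last exact: x1.
    by split; [move=> v _; exact: x0|move=> v; exact: xs].
  by split=> [v|v|//]; [exact: (x0 v I)|exact: xs].
apply: closedI; [apply: closedI|].
- apply: closed_bigI => v _; apply: (closed_le_fun (f := fun=> 0)); last exact: cv.
  exact: cts_cst.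
- apply: closed_bigI => v _; apply: (closed_eq_fun (g := fun=> 0)); first exact: cv.
  exact: cts_cst.
- apply: (closed_eq_fun (g := fun=> 1)); last exact: cts_cst.
  by apply: cts_sum => v; exact: cv.
Qed.

Lemma realization_compact K : compact [set: realization R K].
Proof.
apply: compact_set_type; rewrite realization_setE.
have /finite_seqP[ss ->] := finite_faces K.
rewrite bigcup_seq.
by apply: bigsetU_compact => s _; exact: simplex_compact.
Qed.

(** The segment between the two images of a point stays in the realization because a common simplex,
    which may vary with the point, contains both. *)
Lemma homotopic_on_linear (T : topologicalType) K (B : set T)
    (f g : T -> realization R K) :
  {within B, continuous f} -> {within B, continuous g} ->
  (forall x, B x -> exists s,
    [/\ faces K s, simplex s (coord (f x)) & simplex s (coord (g x))]) ->
  homotopic_on (R := R) B f g.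
Proof.
move=> cf cg fg.
pose h (tx : R * T) v := (1 - tx.1) * coord (f tx.2) v + tx.1 * coord (g tx.2) v.
have hH tx : (`[0, 1]%classic `*` B) tx -> coord (realpt (f tx.2) (h tx)) = h tx.
  case: tx => t x [/= t01 /fg[s [Ks fs gs]]].
  by apply: coord_realpt Ks _; apply: simplex_conv => //; move: t01; rewrite in_itv.
exists (fun tx => realpt (f tx.2) (h tx)); split.
- apply: realization_continuous => v.
  apply: (@within_continuous_eq _ _ _ (fun tx => h tx v)).
    by move=> tx /hH ->.
  have cfst : {within `[0:R, 1]%classic `*` B, continuous (fun tx => tx.1)}.
    by apply: continuous_subspaceT => z; exact: cvg_fst.
  have csnd : {within `[0:R, 1]%classic `*` B, continuous (fun tx => tx.2)}.
    by apply: continuous_subspaceT => z; exact: cvg_snd.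
  have cc (f' : T -> realization R K) : {within B, continuous f'} ->
    {within `[0:R, 1]%classic `*` B, continuous (fun tx => coord (f' tx.2) v)}.
    move=> cf'; have h1 := within_continuous_comp_in csnd cf' (fun z => @proj2 _ _).
    have h2 := continuous_subspaceT (A := setT) (@coord_continuous K v).
    exact: within_continuous_comp_in h1 h2 _.
  apply: ctsD; apply: ctsM => //; [|exact: cc|exact: cc].
  by apply: ctsB => //; exact: cts_cst.
- move=> x Bx; apply: coord_inj => v; rewrite hH/h/=; last first.
    by split=> //=; rewrite in_itv/= lexx ler01.
  by rewrite subr0 mul1r mul0r addr0.
- move=> x Bx; apply: coord_inj => v; rewrite hH/h/=; last first.
    by split=> //=; rewrite in_itv/= lexx ler01.
  by rewrite subrr mul1r mul0r add0r.
Qed.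

End RealizationTopology.

(** * Cones *)

Section Cone.
Context {V : choiceType} (L : fscomplex V) (v : V).

(** The cone lives on the vertex type of [L], so that it can be united with another complex on [V].
    It is the usual cone with apex [v] when [v] is not a vertex of [L]. *)
Definition cone_faces : set {fset V} := [set s | faces L (s `\ v)%fset].

Lemma finite_cone_faces : finite_set cone_faces.
Proof.
have fin : finite_set ((fun p : {fset V} * bool =>
    if p.2 then (v |` p.1)%fset else p.1) @` (faces L `*` setT)).
  apply: finite_image; apply: finite_setX; first exact: finite_faces.
  exact: finite_finset.
apply: sub_finite_set fin => s Ls; exists ((s `\ v)%fset, v \in s) => //=.
by case: ifPn => vs; [rewrite fsetD1K|rewrite mem_fsetD1].
Qed.

Lemma fset0_cone_face : cone_faces fset0.
Proof. by rewrite /cone_faces/= fset0D; exact: fset0_face. Qed.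

Lemma subset_cone_face (s s' : {fset V}) :
  cone_faces s -> (s' `<=` s)%fset -> cone_faces s'.
Proof. by move=> Ls s's; apply: subset_face Ls _; exact: fsetSD. Qed.

Definition cone : fscomplex V :=
  FSComplex finite_cone_faces fset0_cone_face subset_cone_face.

Lemma cone_faceU1 s : cone_faces s -> cone_faces (v |` s)%fset.
Proof. by rewrite /cone_faces/= fsetDUl fsetDv fset0U. Qed.

Context {R : realType}.
Implicit Type z : realization R cone.


(** In [x = (1 - d) v + d y], with [y] in the base and [d = 1 - x v], the depth [d] becomes [k * d]
    and [y] is kept. The collar lines are the segments from the apex, and the collar is the whole
    cone. *)
Definition cone_scale (k : R) (x : V -> R) : V -> R :=
  fun u => if u == v then 1 - k * (1 - x v) else k * x u.

Lemma simplex_cone_scale k x s : 0 <= k -> k * (1 - x v) <= 1 ->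
  v \in s -> simplex s x -> simplex s (cone_scale k x).
Proof.
move=> k0 kx vs [x0 xs x1]; rewrite /cone_scale; split=> [u|u us|].
- by case: ifPn => _; [rewrite subr_ge0|rewrite mulr_ge0].
- by rewrite ifN ?xs ?mulr0//; apply: contraNneq us => ->.
- rewrite (big_fsetD1 v)//= eqxx.
  rewrite (@eq_fbigr _ _ _ _ _ _ _ (fun u => k * x u)); last first.
    by move=> u; rewrite !inE => /andP[/negbTE -> _].
  rewrite -mulr_sumr.
  have := x1; rewrite (big_fsetD1 v)//= => <-.
  by rewrite [x v + _]addrC addrK subrK.
Qed.

Definition cone_depth z : R := 1 - coord z v.

Definition cone_move (kz : R * realization R cone) : realization R cone :=
  realpt kz.2 (cone_scale kz.1 (coord kz.2)).

Lemma coord_cone_move k z : 0 <= k -> k * cone_depth z <= 1 ->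
  coord (cone_move (k, z)) = cone_scale k (coord z).
Proof.
move=> k0 kz; have [s Cs zs] := coord_simplex z.
apply: (coord_realpt (K := cone) z (cone_faceU1 Cs)).
  apply: simplex_cone_scale => //.
  exact: fset1U1.
by apply: simplexS zs; exact: fsubsetU1.
Qed.

Lemma cone_collar : collar cone_depth cone_move.
Proof.
have depthE k z : 0 <= k -> k * cone_depth z <= 1 ->
    cone_depth (cone_move (k, z)) = k * cone_depth z.
  move=> k0 kz; rewrite {1}/cone_depth coord_cone_move// /cone_scale eqxx.
  by rewrite opprB addrCA subrr addr0.
split.
- by apply: ctsB; [exact: cts_cst|exact: coord_continuous].
- by move=> z; rewrite /cone_depth subr_ge0 coord_le1 lerBlDr lerDl coord_ge0.
- apply: realization_continuous => u.
  apply: (@within_continuous_eq _ _ _ (fun kz => cone_scale kz.1 (coord kz.2) u)).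
    by move=> [k z] [/= k1 kz]; rewrite coord_cone_move//; exact: le_trans k1.
  apply: continuous_subspaceT.
  have cc w : continuous (fun kz : R * realization R cone => coord kz.2 w).
    by apply: coord_comp_continuous => kz; exact: cvg_snd.
  have cfst : continuous (fun kz : R * realization R cone => kz.1).
    by move=> kz; exact: cvg_fst.
  rewrite /cone_scale; case: (u == v); last exact: ctsM.
  apply: ctsB; first exact: cts_cst.
  by apply: ctsM => //; apply: ctsB => //; exact: cts_cst.
- move=> z; apply: coord_inj => u; rewrite coord_cone_move//; last first.
    by rewrite mul1r /cone_depth lerBlDr lerDl coord_ge0.
  rewrite /cone_scale !mul1r; case: eqP => [->|//].
  by rewrite opprB addrCA subrr addr0.
- by move=> k z k1 kz; rewrite depthE//; exact: le_trans k1.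
- move=> k l z k1 l1 lkz.
  have k0 : 0 <= k by exact: le_trans k1.
  have l0 : 0 <= l by exact: le_trans l1.
  have d0 : 0 <= cone_depth z by rewrite subr_ge0 coord_le1.
  have kz : k * cone_depth z <= 1.
    apply: le_trans lkz; rewrite -mulrA ler_peMl// mulr_ge0//.
  apply: coord_inj => u; rewrite coord_cone_move// ?depthE ?mulrA//.
  rewrite !coord_cone_move ?mulr_ge0//.
  rewrite /cone_scale eqxx; case: (u == v); last by rewrite mulrA.
  by rewrite opprB addrCA subrr addr0 mulrA.
Qed.

End Cone.

(** * Neighbourhoods of a point of a realization *)

Section BigMin.
Context {R : realType}.

Lemma bigmin_attained (I : eqType) (s : seq I) (f : I -> R) :
  \big[Num.min/1]_(i <- s) f i = 1 \/
  exists2 i, i \in s & \big[Num.min/1]_(i <- s) f i = f i.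
Proof.
elim: s => [|i s IH]; first by left; rewrite big_nil.
rewrite big_cons minEle; case: ifPn => _.
  by right; exists i; rewrite ?mem_head.
by case: IH => [|[j js]]; [left|right; exists j; rewrite // inE js orbT].
Qed.

Lemma cts_bigmin (T : topologicalType) (I : Type) (s : seq I) (F : I -> T -> R) :
  (forall i, continuous (F i)) ->
  continuous (fun x => \big[Num.min/1]_(i <- s) F i x).
Proof.
move=> cF; elim: s => [|i s IH].
  by under [X in continuous X]eq_fun do rewrite big_nil; exact: cts_cst.
by under [X in continuous X]eq_fun do rewrite big_cons; exact: cts_min.
Qed.

End BigMin.

(** The complex is seen as a cone with apex [q]: subdividing it at [q], the
    barycentric coordinate of [x] at [q] is the largest [m] with [m q <= x]. *)
Section PointCollar.
Context {R : realType} {V : choiceType} (K : fscomplex V) (q : realization R K).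
Variable sigma : {fset V}.
Hypotheses (qsigma : simplex sigma (coord q))
  (q_gt0 : forall v, v \in sigma -> 0 < coord q v).

Definition star_coord (x : realization R K) : R :=
  \big[Num.min/1]_(v <- sigma) (coord x v / coord q v).

(** If [x = m q + (1 - m) y], the move leads to [k m q + (1 - k m) y], so the remainder [x - m q] is
    multiplied by this ratio. At [q] the remainder is 0 and the convention [0^-1 = 0] is
    harmless. *)
Definition star_ratio (k : R) (x : realization R K) : R :=
  (1 - k * star_coord x) / (1 - star_coord x).

Definition star_scale (k : R) (x : realization R K) : V -> R := fun v =>
  k * star_coord x * coord q v
    + star_ratio k x * (coord x v - star_coord x * coord q v).

Definition star_move (kx : R * realization R K) : realization R K :=
  realpt kx.2 (star_scale kx.1 kx.2).

Lemma star_coord_le1 x : star_coord x <= 1.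
Proof. by rewrite /star_coord; exact: bigmin_le_id. Qed.

Lemma star_coord_ge0 x : 0 <= star_coord x.
Proof.
rewrite /star_coord; elim/big_ind: _ => // [a b a0 b0|v _].
  by rewrite le_min a0.
by rewrite divr_ge0// coord_ge0.
Qed.

Lemma star_coord_mul_le x v : star_coord x * coord q v <= coord x v.
Proof.
have [q0 qs _] := qsigma; have [vs|/qs ->] := boolP (v \in sigma); last first.
  by rewrite mulr0 coord_ge0.
rewrite -ler_pdivlMr ?q_gt0//; exact: ge_bigmin_seq.
Qed.

(** Then [q <= x] in each coordinate, and both have total mass 1. *)
Lemma star_coord_eq1 x : star_coord x = 1 -> x = q.
Proof.
move=> x1; have [s Ks [x0 xs sumx]] := coord_simplex x.
have [q0 qs sumq] := qsigma.
have le v : coord q v <= coord x v by rewrite -[leLHS]mul1r -x1 star_coord_mul_le.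
have qs' v : v \notin s -> coord q v = 0.
  by move=> /xs xv; apply/eqP; rewrite eq_le q0 andbT -xv.
apply: coord_inj => v; have [vs|vs] := boolP (v \in s); last by rewrite xs ?qs'.
apply/eqP; rewrite -subr_eq0 eq_le subr_ge0 le andbT.
have : \sum_(u <- s) (coord x u - coord q u) = 0.
  by rewrite sumrB sumx (sum_supp qs' qs) sumq subrr.
rewrite (big_fsetD1 v)//= => /eqP; rewrite addr_eq0 => /eqP ->.
by rewrite oppr_le0 sumr_ge0// => u _; rewrite subr_ge0.
Qed.

Lemma star_coordq : star_coord q = 1.
Proof.
have [//|[v vs e]] := bigmin_attained sigma (fun v => coord q v / coord q v).
by rewrite /star_coord e divff// gt_eqF ?q_gt0.
Qed.

Lemma star_ratio_itv k x : 1 <= k -> k * star_coord x <= 1 ->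
  0 <= star_ratio k x <= 1.
Proof.
move=> k1 kx; rewrite /star_ratio; have := star_coord_le1 x.
rewrite le_eqVlt => /orP[/eqP ->|m1]; first by rewrite subrr invr0 mulr0 lexx ler01.
rewrite divr_ge0 ?subr_ge0//= ?(ltW m1)// ler_pdivrMr ?subr_gt0// mul1r.
by rewrite lerD2l lerN2 ler_peMl// star_coord_ge0.
Qed.

Lemma star_ratioM k x : 1 <= k -> k * star_coord x <= 1 ->
  star_ratio k x * (1 - star_coord x) = 1 - k * star_coord x.
Proof.
move=> k1 kx; rewrite /star_ratio; have [m1|m1] := eqVneq (star_coord x) 1.
  rewrite m1 subrr mulr0 mulr1; apply/eqP; rewrite eq_sym subr_eq0 eq_le k1.
  by move: kx; rewrite m1 mulr1 => ->.
by rewrite divfK// subr_eq0 eq_sym.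
Qed.

Lemma simplex_star_scale k x s : 1 <= k -> k * star_coord x <= 1 ->
  simplex s (coord x) -> simplex s (star_scale k x).
Proof.
move=> k1 kx [x0 xs x1]; have k0 : 0 <= k by exact: le_trans k1.
have /andP[r0 r1] := star_ratio_itv k1 kx.
have [q0 qs sumq] := qsigma.
have mqs v : v \notin s -> star_coord x * coord q v = 0.
  move=> /xs xv; apply/eqP; rewrite eq_le mulr_ge0 ?star_coord_ge0// andbT.
  by have := star_coord_mul_le x v; rewrite xv.
have mqsigma v : v \notin sigma -> star_coord x * coord q v = 0.
  by move=> /qs ->; rewrite mulr0.
split=> [v|v vs|].
- rewrite /star_scale addr_ge0// mulr_ge0// ?mulr_ge0 ?star_coord_ge0//.
  by rewrite subr_ge0; exact: star_coord_mul_le.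
- by rewrite /star_scale -mulrA mqs// xs// subr0 !mulr0 addr0.
- have mq : \sum_(v <- s) star_coord x * coord q v = star_coord x.
    by rewrite (sum_supp mqs mqsigma) -mulr_sumr sumq mulr1.
  rewrite big_split/= -[X in _ + X]mulr_sumr sumrB x1 mq star_ratioM//.
  under eq_bigr do rewrite -mulrA.
  by rewrite -mulr_sumr mq addrC subrK.
Qed.

Lemma coord_star_move k x : 1 <= k -> k * star_coord x <= 1 ->
  coord (star_move (k, x)) = star_scale k x.
Proof.
move=> k1 kx; have [s Ks xs] := coord_simplex x.
by apply: (coord_realpt x Ks); exact: simplex_star_scale.
Qed.

(** After the move each quotient is [k m] plus a nonnegative multiple of [x v / q v - m], so the
    minimum is reached where it was before. The case [m = 1] is separate, as the minimum may then be
    the initial value 1; there [x = q] and [k = 1]. *)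
Lemma star_coord_move k x : 1 <= k -> k * star_coord x <= 1 ->
  star_coord (star_move (k, x)) = k * star_coord x.
Proof.
move=> k1 kx; have /andP[r0 r1] := star_ratio_itv k1 kx.
have divE v : v \in sigma -> coord (star_move (k, x)) v / coord q v =
    k * star_coord x + star_ratio k x * (coord x v / coord q v - star_coord x).
  move=> vs; have qv : coord q v != 0 by rewrite gt_eqF ?q_gt0.
  rewrite coord_star_move// /star_scale mulrDl mulfK//; congr (_ + _).
  by rewrite -mulrA mulrBl mulfK.
have [m1|m1] := eqVneq (star_coord x) 1.
  have {}k1 : k = 1.
    by apply/eqP; rewrite eq_le k1 andbT; move: kx; rewrite m1 mulr1.
  rewrite k1 mul1r; have xq := star_coord_eq1 m1; congr star_coord.
  apply: coord_inj => v; rewrite coord_star_move// ?mul1r ?star_coord_le1//.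
  by rewrite /star_scale m1 xq !mul1r subrr mulr0 addr0.
apply/eqP; rewrite eq_le; apply/andP; split.
  have [/eqP|[v vs e]] := bigmin_attained sigma (fun v => coord x v / coord q v).
    by rewrite -/(star_coord x) (negbTE m1).
  apply: (@le_trans _ _ (coord (star_move (k, x)) v / coord q v)).
    exact: ge_bigmin_seq.
  by rewrite divE// -e subrr mulr0 addr0.
rewrite [leRHS]/star_coord big_seq; apply: le_bigmin => // v vs.
rewrite divE// lerDl mulr_ge0// subr_ge0; exact: ge_bigmin_seq.
Qed.

Lemma star_move_move k l x : 1 <= k -> 1 <= l -> l * k * star_coord x <= 1 ->
  star_move (l, star_move (k, x)) = star_move (l * k, x).
Proof.
move=> k1 l1 lkx.
have k0 : 0 <= k by exact: le_trans k1.
have l0 : 0 <= l by exact: le_trans l1.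
have kx : k * star_coord x <= 1.
  by apply: le_trans lkx; rewrite -mulrA ler_peMl// mulr_ge0// star_coord_ge0.
have lk1 : 1 <= l * k by rewrite mulr_ege1.
apply: coord_inj => v.
rewrite coord_star_move// ?star_coord_move ?mulrA// (coord_star_move lk1)//.
rewrite /star_scale coord_star_move// star_coord_move// mulrA; congr (_ + _).
rewrite /star_scale addrAC subrr add0r mulrA; congr (_ * _).
rewrite {1}/star_ratio star_coord_move// mulrA.
have [km|km] := eqVneq (k * star_coord x) 1.
  have ll : l = 1.
    by apply/eqP; rewrite eq_le l1 andbT; move: lkx; rewrite -mulrA km mulr1.
  by rewrite /star_ratio km ll !mul1r km subrr !mul0r.
by rewrite divfK ?subr_eq0 1?eq_sym// /star_ratio mulrA.
Qed.

Lemma star_coord_continuous : continuous star_coord.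
Proof.
apply: cts_bigmin => v; apply: ctsM; [exact: coord_continuous|exact: cts_cst].
Qed.

Lemma star_move_continuous :
  {within [set kx : R * realization R K | 1 <= kx.1 /\ kx.1 * star_coord kx.2 <= 1],
    continuous star_move}.
Proof.
set D := [set kx | _]; apply: realization_continuous => v.
apply: (@within_continuous_eq _ _ _ (fun kx => star_scale kx.1 kx.2 v)).
  by move=> [k x] [/= k1 kx]; rewrite coord_star_move.
have cfst : continuous (fun kx : R * realization R K => kx.1).
  by move=> z; exact: cvg_fst.
have csnd : continuous (fun kx : R * realization R K => kx.2).
  by move=> z; exact: cvg_snd.
have cm : continuous (fun kx : R * realization R K => star_coord kx.2).
  by move=> z; apply: continuous_comp; [exact: csnd|exact: star_coord_continuous].
pose d (kx : R * realization R K) := coord kx.2 v - star_coord kx.2 * coord q v.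
have cd : continuous d.
  apply: ctsB; first exact: coord_comp_continuous.
  by apply: ctsM => //; exact: cts_cst.
apply: ctsD.
  apply: continuous_subspaceT; apply: ctsM; last exact: cts_cst.
  exact: ctsM.
apply/subspace_continuousP => -[k x] Dkx.
have cd' : d @ within D (nbhs (k, x)) --> d (k, x) :=
  (subspace_continuousP _ _).1 (continuous_subspaceT (A := D) cd) _ Dkx.
(* At [q] the ratio is a quotient 0/0 with no continuous extension to rely on; but it stays in
   [[0, 1]] on [D] and multiplies [d], which tends to 0. *)
have [m1|m1] := eqVneq (star_coord x) 1.
  have d0 : d (k, x) = 0.
    by rewrite /d/= m1 (star_coord_eq1 m1) mul1r subrr.
  rewrite d0 in cd'; rewrite [X in _ --> X](_ : _ = 0); last first.
    by rewrite -/(d (k, x)) d0 mulr0.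
  apply: (@squeeze_cvgr _ _ _ _ (fun kx => - `|d kx|) (fun kx => `|d kx|)).
  - apply: filterS (withinT _ _) => -[k' x'] [/= k'1 k'x'].
    rewrite -ler_norml normrM ler_piMl//.
    by have /andP[? ?] := star_ratio_itv k'1 k'x'; rewrite ger0_norm.
  - by rewrite -oppr0 -(normr0 R); apply: cvgN; apply: cvg_norm.
  - by rewrite -(normr0 R); apply: cvg_norm.
apply: cvgM => //; apply: cvgM.
  apply: (subspace_continuousP _ _).1 _ Dkx.
  apply: continuous_subspaceT; apply: ctsB; first exact: cts_cst.
  exact: ctsM.
apply: cvgV; first by rewrite subr_eq0 eq_sym.
apply: (subspace_continuousP _ _).1 _ Dkx.
by apply: continuous_subspaceT; apply: ctsB; first exact: cts_cst.
Qed.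

Lemma star_collar : collar star_coord star_move.
Proof.
split.
- exact: star_coord_continuous.
- by move=> x; rewrite star_coord_ge0 star_coord_le1.
- exact: star_move_continuous.
- move=> x; apply: coord_inj => v; rewrite coord_star_move ?mul1r ?star_coord_le1//.
  rewrite /star_scale /star_ratio mul1r; have [m1|m1] := eqVneq (star_coord x) 1.
    by rewrite m1 (star_coord_eq1 m1) !mul1r !subrr mulr0 addr0.
  by rewrite divff ?mul1r ?[_ + (_ - _)]addrC ?subrK// subr_eq0 eq_sym.
- by move=> k x; exact: star_coord_move.
- by move=> k l x; exact: star_move_move.
Qed.

End PointCollar.

Lemma point_collar (R : realType) (V : choiceType) (K : fscomplex V)
    (q : realization R K) :
  exists m e, @collar R (realization R K) m e /\ (forall x, m x = 1 <-> x = q).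
Proof.
have [s Ks [q0 qs sumq]] := coord_simplex q.
(* The support of [q], so that no denominator in [star_coord] vanishes. *)
pose sigma := [fset v in s | coord q v != 0]%fset.
have qsigma : simplex sigma (coord q).
  have qsig v : v \notin sigma -> coord q v = 0.
    rewrite !inE negb_and => /orP[/qs//|]; by rewrite negbK => /eqP.
  by split=> //; rewrite (sum_supp qsig qs).
have q_gt0 v : v \in sigma -> 0 < coord q v.
  by rewrite !inE => /andP[_ qv]; rewrite lt_neqAle eq_sym qv coord_ge0.
exists (star_coord q sigma), (star_move q sigma); split.
  exact: star_collar.
move=> x; split=> [|->]; first exact: star_coord_eq1.
exact: star_coordq.
Qed.

(** * Wedges *)

Section Wedge2.
Context {X Y : topologicalType} (x0 : X) (y0 : Y).

Local Notation fam := (fun b : bool => if b then X else Y).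
Local Notation base :=
  (fun b => if b return (if b then X else Y : topologicalType) then x0 else y0).

Definition wedge_inl (x : X) : wedge2 x0 y0 := @wedge_lift bool fam base true x.
Definition wedge_inr (y : Y) : wedge2 x0 y0 := @wedge_lift bool fam base false y.

Lemma wedge_inl_continuous : continuous wedge_inl.
Proof. exact: (@wedge_lift_continuous bool fam base true). Qed.

Lemma wedge_inr_continuous : continuous wedge_inr.
Proof. exact: (@wedge_lift_continuous bool fam base false). Qed.

Lemma wedge_inl_inj : injective wedge_inl.
Proof.
move=> x x' /eqmodP/predU1P[e|/andP[/eqP /= -> /eqP /= ->]//].
exact: existT_inj2 e.
Qed.

Lemma wedge_inr_inj : injective wedge_inr.
Proof.
move=> x x' /eqmodP/predU1P[e|/andP[/eqP /= -> /eqP /= ->]//].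
exact: existT_inj2 e.
Qed.

Lemma wedge_inlr x y : wedge_inl x = wedge_inr y <-> x = x0 /\ y = y0.
Proof.
split=> [/eqmodP/predU1P[e|/andP[/eqP /= -> /eqP /= ->]//]|[-> ->]].
  by have := existT_inj1 e.
by apply/eqmodP/orP; right; rewrite !eqxx.
Qed.

Lemma wedge2_cover (p : wedge2 x0 y0) :
  (exists x, wedge_inl x = p) \/ (exists y, wedge_inr y = p).
Proof.
have : [set: wedge base] p by [].
by rewrite -wedgeTE => -[[] _ [z _ <-]]; [left|right]; exists z.
Qed.

Lemma wedge2_hausdorff :
  hausdorff_space X -> hausdorff_space Y -> hausdorff_space (wedge2 x0 y0).
Proof. by move=> hX hY; apply: wedge_hausdorff => -[]. Qed.

End Wedge2.

Section WedgeBasePoint.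
Context {R : realType} {X Y : topologicalType}.
Hypotheses (kX : compact [set: X]) (kY : compact [set: Y])
  (hX : hausdorff_space X) (hY : hausdorff_space Y).

Lemma glued_wedge2 (x0 : X) (y0 : Y) :
  glued (R := R) [set x0] (fun=> y0) (wedge_inr x0 y0) (wedge_inl x0 y0).
Proof.
apply: glued_compact => //.
- exact: wedge2_hausdorff.
- exact: wedge_inr_continuous.
- exact: wedge_inl_continuous.
- exact: wedge_inr_inj.
- by move=> x ->; apply/wedge_inlr.
- by move=> y x /esym/wedge_inlr[].
- by move=> x x' _ /wedge_inl_inj.
- by move=> p; have [?|?] := wedge2_cover p; [right|left].
Qed.

(** A wedge is [Y] with [X] attached along the point [x0], by a constant map. A path from [y0] to
    [y1] is a homotopy of attaching maps, absorbed by the collar of [x0]. *)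
Lemma wedge2_base_change (x0 : X) (y0 y1 : Y) m e :
  @collar R X m e -> (forall x, m x = 1 <-> x = x0) ->
  homotopic_on (R := R) [set x0] (fun=> y0) (fun=> y1) ->
  homotopy_equivalent R (wedge2 x0 y0) (wedge2 x0 y1).
Proof.
move=> me mx0 y01.
have B : [set x | m x = 1] = [set x0] by apply/seteqP; split=> x /mx0.
by apply: (glued_homotopy_equivalent me); rewrite ?B; [| |exact: y01];
  exact: glued_wedge2.
Qed.

End WedgeBasePoint.

(** * Unions and suspensions *)

Section Inclusion.
Context {R : realType} {V : choiceType} {K K' : fscomplex V}.
Hypothesis KK' : forall s, faces K s -> faces K' s.

Lemma realization_set_sub : @realization_set R V K `<=` @realization_set R V K'.
Proof. by rewrite !realization_setE => x [s Ks sx]; exists s => //; exact: KK'. Qed.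

Definition inclusion (x : realization R K) : realization R K' :=
  exist _ (coord x) (mem_set (realization_set_sub (set_valP x))).

Lemma inclusion_continuous : continuous inclusion.
Proof. by apply: realization_continuous => v; exact: coord_continuous. Qed.

End Inclusion.

Section UnionComplex.
Context {V : choiceType} (K L : fscomplex V).

Definition union_complex : fscomplex V.
Proof.
apply: (@FSComplex _ (faces K `|` faces L)).
- by rewrite finite_setU; split; exact: finite_faces.
- by left; exact: fset0_face.
- by move=> s s' [] h s's; [left|right]; exact: subset_face s's.
Defined.

End UnionComplex.

Lemma mem_join_inl {V W : choiceType} (s1 : {fset V}) (s2 : {fset W}) u :
  (inl u \in join_face s1 s2) = (u \in s1).
Proof.
rewrite /join_face in_fsetU; apply/orP/idP => [[] /imfsetP[y /= ys]|us].
- by case=> ->.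
- by [].
- by left; apply/imfsetP; exists u.
Qed.

Lemma mem_join_inr {V W : choiceType} (s1 : {fset V}) (s2 : {fset W}) u :
  (inr u \in join_face s1 s2) = (u \in s2).
Proof.
rewrite /join_face in_fsetU; apply/orP/idP => [[] /imfsetP[y /= ys]|us].
- by [].
- by case=> ->.
- by right; apply/imfsetP; exists u.
Qed.

Lemma sum_join_face {R : realType} {V W : choiceType} (s1 : {fset V})
    (s2 : {fset W}) (x : V + W -> R) :
  \sum_(u <- join_face s1 s2) x u =
  \sum_(u <- s1) x (inl u) + \sum_(u <- s2) x (inr u).
Proof.
rewrite -(big_map inl xpredT x) -(big_map inr xpredT x) -big_cat/=.
apply: perm_big; apply: uniq_perm => [||[u|u]].
- exact: fset_uniq.
- rewrite cat_uniq !map_inj_uniq ?fset_uniq/= ?andbT; try by move=> ? ? [].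
  by apply/hasPn => _ /mapP[y _ ->]; apply/mapP => -[].
- by rewrite mem_join_inl mem_cat mem_map ?[_ \in map inr _](introF mapP) ?orbF//;
    [move=> []|move=> ? ? []].
- by rewrite mem_join_inr mem_cat mem_map ?[_ \in map inl _](introF mapP)//;
    [move=> []|move=> ? ? []].
Qed.

Section Suspension.
Context {R : realType} {V : choiceType} (L : fscomplex V).
Implicit Types (x : V + bool -> R) (y : realization R (suspension L)).

Lemma suspension_face s b :
  faces L s -> faces (suspension L) (join_face s [fset b]%fset).
Proof. by move=> Ls; exists s, [fset b]%fset; split=> //; right; exists b. Qed.

Lemma suspension_simplexP s b x : simplex (join_face s [fset b]%fset) x <->
  [/\ forall u, 0 <= x u, forall u, u \notin s -> x (inl u) = 0, x (inr (~~ b)) = 0 &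
      \sum_(u <- s) x (inl u) + x (inr b) = 1].
Proof.
split=> [[x0 xs x1]|[x0 xs xb x1]]; split=> //.
- by move=> u us; apply: xs; rewrite mem_join_inl.
- by apply: xs; rewrite mem_join_inr inE; case: (b).
- by rewrite -x1 sum_join_face big_seq_fset1.
- move=> [u|b']; rewrite ?mem_join_inl ?mem_join_inr; first exact: xs.
  rewrite inE => b'b; have -> : b' = ~~ b by case: (b) b' b'b => -[].
  exact: xb.
- by rewrite sum_join_face big_seq_fset1.
Qed.

Lemma suspension_coord y : exists s b, faces L s /\
  simplex (join_face s [fset b]%fset) (coord y).
Proof.
have [_ [s [s' [Ls s'P ->]]] sy] := coord_simplex y.
have [b s'b] : exists b, (s' `<=` [fset b])%fset.
  by case: s'P => [->|[b ->]]; [exists true; exact: fsub0set|exists b].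
exists s, b; split=> //; apply: simplexS sy; apply/fsubsetP => -[u|b'].
  by rewrite !mem_join_inl.
by rewrite !mem_join_inr; exact: (fsubsetP s'b).
Qed.

End Suspension.

(** The cone [v * L] maps onto the suspension: its base [L] is crushed to the
    pole [b] and its apex [v] is sent to the pole [~~ b].  A point with
    coordinate [s] at [v] keeps its direction in [L], with total mass
    [2 * min(s, 1 - s)]. *)
Section ConeToSuspension.
Context {R : realType} {V : choiceType} (L : fscomplex V) (v : V) (b : bool).
Hypothesis vL : forall s, faces L s -> v \notin s.
Implicit Types (z : realization R (cone L v)) (y : realization R (suspension L)).

Variables (q : realization R (suspension L)).
Hypothesis q_pole : coord q = dirac_pt (inr b).

(** With [s = x v], the mass [1 - s] outside the apex must become [2 * min(s, 1 - s)]. The factor is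
    written [2 s / max(s, 1 - s)], by [min * max = s (1 - s)], to avoid a denominator that vanishes
    at the apex. *)
Definition cone_suspension_fun (x : V -> R) : V + bool -> R := fun u =>
  match u with
  | inl u => if u == v then 0 else x u * (2 * x v / Num.max (x v) (1 - x v))
  | inr b' => if b' == b then Num.max 0 (1 - 2 * x v) else Num.max 0 (2 * x v - 1)
  end.

Definition cone_suspension z : realization R (suspension L) :=
  realpt q (cone_suspension_fun (coord z)).

Let max_gt0 (a : R) : 0 < Num.max a (1 - a).
Proof. by rewrite lt_max; have [|] := ltP 0 a => // ?; lra. Qed.

Lemma cone_simplex z : exists2 s, faces L s & simplex (v |` s)%fset (coord z).
Proof.
have [s Ls sz] := coord_simplex z; exists (s `\ v)%fset => //.
apply: simplexS sz; apply/fsubsetP => u us; rewrite !inE us andbT.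
by case: (u == v).
Qed.

Lemma cone_sum z s : faces L s -> simplex (v |` s)%fset (coord z) ->
  \sum_(u <- s) coord z u = 1 - coord z v.
Proof.
move=> Ls [_ _]; rewrite (big_fsetD1 v) ?fset1U1//= fsetU1K ?vL// => <-.
by rewrite addrC addrK.
Qed.

Lemma coord_cone_suspension z :
  coord (cone_suspension z) = cone_suspension_fun (coord z).
Proof.
have [s Ls sz] := cone_simplex z; have [z0 zs _] := sz.
pose b' := if coord z v <= 2^-1 then b else ~~ b.
apply: (coord_realpt q (suspension_face b' Ls)); apply/suspension_simplexP.
have m0 := max_gt0 (coord z v).
split=> /=.
- move=> [u|b''] /=; last by case: ifP => _; rewrite le_max lexx.
  by case: ifP => // _; rewrite mulr_ge0 ?divr_ge0 ?mulr_ge0 ?coord_ge0// ltW.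
- move=> u us; case: ifPn => // uv; rewrite zs ?mul0r//.
  by rewrite !inE negb_or uv.
- rewrite /b'; case: (leP (coord z v) 2^-1) => h.
    by rewrite ifN; [rewrite max_l//; lra|case: (b)].
  by rewrite negbK eqxx max_l//; lra.
- rewrite (@eq_fbigr _ _ _ _ _ _ _
    (fun u => coord z u * (2 * coord z v / Num.max (coord z v) (1 - coord z v)))).
    rewrite -mulr_suml (cone_sum Ls sz) /b'; case: (leP (coord z v) 2^-1) => h.
      rewrite eqxx (max_r (_ : 0 <= _)) ?(max_r (_ : _ <= 1 - _)); try lra.
      by rewrite mulrCA divff ?mulr1; lra.
    rewrite ifN; last by case: (b).
    rewrite (max_r (_ : 0 <= _)) ?(max_l (_ : 1 - _ <= _)); try lra.
    by rewrite mulfK; lra.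
  by move=> u us; rewrite ifN//; apply: contraNneq (vL Ls) => <-.
Qed.

Lemma cone_suspension_continuous : continuous cone_suspension.
Proof.
apply: realization_continuous => u.
rewrite (_ : (fun _ => _) = fun z => cone_suspension_fun (coord z) u); last first.
  by apply/funext => z; rewrite coord_cone_suspension.
have cv w := @coord_continuous R V (cone L v) w.
case: u => [u|b'] /=.
  case: (u == v); first exact: cts_cst.
  apply: ctsM => //; apply: ctsM; first exact: ctsMl.
  apply: ctsV => [z|]; first by rewrite gt_eqF.
  by apply: cts_max => //; apply: ctsB => //; exact: cts_cst.
case: (b' == b); apply: cts_max; try exact: cts_cst.
  by apply: ctsB; [exact: cts_cst|exact: ctsMl].
by apply: ctsB; [exact: ctsMl|exact: cts_cst].
Qed.

Lemma cone_suspension_base z : cone_suspension z = q <-> coord z v = 0.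
Proof.
split=> [zq|zv0].
  have : coord (cone_suspension z) (inr b) = 1 by rewrite zq q_pole /dirac_pt eqxx.
  rewrite coord_cone_suspension /= eqxx; have z0 := coord_ge0 z v.
  by case: leP => ? ?; lra.
apply: coord_inj => u; rewrite coord_cone_suspension q_pole /dirac_pt.
case: u => [u|b'] /=; rewrite zv0; first by case: ifP; rewrite // mulr0 mul0r mulr0.
rewrite mulr0 subr0 sub0r (inj_eq (@inr_inj _ _)); case: ifP => _.
  by rewrite max_r.
by rewrite max_l// oppr_le0.
Qed.

(** The coordinates at the poles differ by [2 s - 1], hence determine the apex coordinate [s]; away
    from the base the factor on the other coordinates is nonzero and cancels. *)
Lemma cone_suspension_inj z z' : coord z v != 0 ->
  cone_suspension z = cone_suspension z' -> z = z'.
Proof.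
move=> zv0 zz'.
have e u : cone_suspension_fun (coord z) u = cone_suspension_fun (coord z') u.
  by rewrite -!coord_cone_suspension zz'.
have zvE : coord z v = coord z' v.
  have nb : (~~ b == b) = false by case: (b).
  have := e (inr b); have := e (inr (~~ b)); rewrite /= eqxx nb.
  by do 4 (case: leP => ?); move=> ? ?; lra.
apply: coord_inj => u; have [->//|uv] := eqVneq u v.
have := e (inl u); rewrite /= (negbTE uv) -zvE; apply: mulIf.
by rewrite !mulf_neq0 ?invr_eq0 ?pnatr_eq0// gt_eqF.
Qed.

(** The pole [q] is listed apart because it has no preimage when [L] has no vertex, the base of the
    cone being empty. *)
Lemma cone_suspension_surj y : y = q \/ exists z, cone_suspension z = y.
Proof.
have [s [c [Ls /suspension_simplexP[y0 ys yc y1]]]] := suspension_coord y.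
pose N := coord y (inr (~~ b)); pose S := coord y (inr b).
have NS : N = 0 \/ S = 0.
  by rewrite /N /S; move: yc; clear; case: (c); case: (b); [left|right|right|left].
have sumE : \sum_(u <- s) coord y (inl u) = 1 - N - S.
  apply/eqP; rewrite -addrA -opprD eq_sym subr_eq eq_sym -y1 (addrC N).
  apply/eqP; congr (_ + _); move: yc; rewrite /N /S; clear.
  by case: (c); case: (b) => /= ->; rewrite ?addr0 ?add0r.
have N0 : 0 <= N by exact: coord_ge0.
have S0 : 0 <= S by exact: coord_ge0.
have NS1 : 0 <= 1 - N - S by rewrite -sumE sumr_ge0.
(* For an image point [N - S] is [2 s - 1], so this is the only possible apex coordinate of a
   preimage. *)
pose a := (1 + N - S) / 2.
have [a0|a0] := eqVneq a 0.
  left; have S1 : S = 1 by move: a0; rewrite /a; case: NS => ->; lra.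
  have NE : N = 0 by case: NS => //; rewrite S1 => /eqP; rewrite oner_eq0.
  move: sumE; rewrite NE S1 subr0 subrr => sum0.
  apply: coord_inj => -[u|b']; rewrite q_pole /dirac_pt /=.
    have [us|/ys->//] := boolP (u \in s).
    move/eqP: sum0; rewrite psumr_eq0// => /allP/(_ _ us)/eqP.
    exact.
  rewrite (inj_eq (@inr_inj _ _)).
  by case: eqP => [->//|b'b]; have -> : b' = ~~ b by case: (b) b' b'b => -[].
right.
have a_gt0 : 0 < a by rewrite lt_neqAle eq_sym a0/= /a; case: NS => ->; lra.
have m0 := max_gt0 a.
pose x u := if u == v then a else coord y (inl u) * (Num.max a (1 - a) / (2 * a)).
have vs := vL Ls.
have sx : simplex (v |` s)%fset x.
  rewrite /x; split=> [u|u|].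
  - case: ifP => _; first exact: ltW.
    apply: mulr_ge0; first exact: coord_ge0.
    by apply: divr_ge0; [exact: ltW|rewrite mulr_ge0// ltW].
  - by rewrite !inE negb_or => /andP[/negbTE -> /ys ->]; rewrite mul0r.
  - rewrite (big_fsetD1 v) ?fset1U1//= fsetU1K// eqxx.
    rewrite (@eq_fbigr _ _ _ _ _ _ _
      (fun u => coord y (inl u) * (Num.max a (1 - a) / (2 * a)))).
      rewrite -mulr_suml sumE.
      have [NE|SE] := NS.
        have -> : 1 - N - S = 2 * a by rewrite /a; lra.
        have a1 : a <= 1 - a by rewrite /a; lra.
        have a2 : 2 * a != 0 by rewrite mulf_eq0 negb_or a0 pnatr_eq0.
        by rewrite (max_r a1) [2 * a * _]mulrC divfK// addrC subrK.
      have -> : 1 - N - S = 2 * (1 - a) by rewrite /a; lra.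
      have a1 : 1 - a <= a by rewrite /a; lra.
      have a2 : a / (2 * a) = 2^-1 by rewrite invfM mulrCA divff// mulr1.
      by rewrite (max_l a1) a2 mulrAC divff ?pnatr_eq0// mul1r addrC subrK.
    by move=> u us; rewrite ifN//; apply: contraNneq vs => <-.
have Cs : faces (cone L v) (v |` s)%fset by rewrite /=/cone_faces/= fsetU1K.
have [z zx] := coord_surj Cs sx; exists z; apply: coord_inj => u.
rewrite coord_cone_suspension zx /x; case: u => [u|b'] /=; rewrite eqxx.
  have [->|uv] := eqVneq u v; first by rewrite ys.
  rewrite -[RHS]mulr1 -[LHS]mulrA -[2 * a / _]invf_div divff//.
  by rewrite mulf_neq0 ?gt_eqF// invr_gt0 mulr_gt0.
have -> : 2 * a = 1 + N - S by rewrite /a; lra.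
case: ifPn => [/eqP ->|b'b].
  by rewrite -/S; case: NS => ?; [rewrite max_r|rewrite max_l]; lra.
have -> : b' = ~~ b by case: (b) b' b'b => -[].
by rewrite -/N; case: NS => ?; [rewrite max_l|rewrite max_r]; lra.
Qed.

(** Attaching along a constant map crushes the base of the cone, which turns the cone into the
    suspension with its pole [q] glued to [p]. *)
Lemma glued_cone_suspension (A : fscomplex V) (p : realization R A) :
  glued (R := R) [set z : realization R (cone L v) | cone_depth z = 1] (fun=> p)
    (wedge_inl p q) (wedge_inr p q \o cone_suspension).
Proof.
have depth z : cone_depth z = 1 <-> coord z v = 0.
  by rewrite /cone_depth; split=> ?; lra.
apply: glued_compact.
- exact: realization_compact.
- exact: realization_compact.
- by apply: wedge2_hausdorff; exact: realization_hausdorff.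
- exact: wedge_inl_continuous.
- move=> z; apply: continuous_comp; first exact: cone_suspension_continuous.
  exact: wedge_inr_continuous.
- exact: wedge_inl_inj.
- move=> z /depth/cone_suspension_base zq; apply/esym/wedge_inlr; split=> //.
- by move=> x z /wedge_inlr[_ /cone_suspension_base/depth].
- move=> z z' zB /wedge_inr_inj; apply: cone_suspension_inj.
  by apply/eqP => /depth.
- move=> w; have [?|[y <-]] := wedge2_cover w; first by left.
  have [->|[z <-]] := cone_suspension_surj y; last by right; exists z.
  by left; exists p; apply/wedge_inlr.
Qed.

End ConeToSuspension.

Section UnionGlue.
Context {R : realType} {V : choiceType} (A L : fscomplex V) (v : V).
Hypotheses (LA : forall s, faces L s -> faces A s)
  (vA : forall s, faces A s -> v \notin s).

Let K0 := union_complex A (cone L v).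

(** On the base this is the inclusion of [L] in [A], with unchanged coordinates; [p] is only a
    default for the other points. *)
Definition cone_base_map (p : realization R A) (z : realization R (cone L v)) :
  realization R A := realpt p (coord z).

Lemma cone_base_simplex (z : realization R (cone L v)) : coord z v = 0 ->
  exists2 s, faces L s & simplex s (coord z).
Proof.
move=> zv0; have [s Ls [z0 zs z1]] := coord_simplex z.
exists (s `\ v)%fset => //.
have zs' u : u \notin (s `\ v)%fset -> coord z u = 0.
  by rewrite !inE negb_and negbK => /orP[/eqP ->|/zs].
by split=> //; rewrite (sum_supp zs' zs).
Qed.

Lemma coord_cone_base_map p z : cone_depth z = 1 ->
  coord (cone_base_map p z) = coord z.
Proof.
move=> zB; have [|s Ls sz] := @cone_base_simplex z.
  by move: zB; rewrite /cone_depth; lra.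
exact: (coord_realpt p (LA Ls)).
Qed.

(** Since [v] is not a vertex of [A], a point common to [A] and the cone has coordinate 0 at [v],
    that is, depth 1. *)
Lemma glued_union (p : realization R A) :
  glued (R := R) [set z : realization R (cone L v) | cone_depth z = 1]
    (cone_base_map p)
    (inclusion (K' := K0) (fun s As => or_introl As))
    (inclusion (K' := K0) (fun s Cs => or_intror Cs)).
Proof.
apply: glued_compact.
- exact: realization_compact.
- exact: realization_compact.
- exact: realization_hausdorff.
- exact: inclusion_continuous.
- exact: inclusion_continuous.
- move=> x x' /(congr1 (@coord _ _ _)) xx'; apply: coord_inj => u.
  exact: (congr1 (@^~ u) xx').
- move=> z zB; apply: coord_inj => u; rewrite /inclusion /=.
  exact: (esym (congr1 (@^~ u) (coord_cone_base_map p zB))).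
- move=> x z /(congr1 (@coord _ _ _))/(congr1 (@^~ v)) /= xz.
  have [s As [_ xs _]] := coord_simplex x.
  have : coord x v = coord z v by exact: xz.
  by rewrite /cone_depth xs ?vA// => <-; rewrite subr0.
- move=> z z' _ /(congr1 (@coord _ _ _)) zz'; apply: coord_inj => u.
  exact: (congr1 (@^~ u) zz').
- move=> w; have [s [As|Cs] sw] := coord_simplex w.
    left; have [x xw] := coord_surj As sw; exists x; apply: coord_inj => u.
    exact: (congr1 (@^~ u) xw).
  right; have [z zw] := coord_surj Cs sw; exists z; apply: coord_inj => u.
  exact: (congr1 (@^~ u) zw).
Qed.

End UnionGlue.

(** * Attaching a cone to a complex *)

(** [K] is the union of [A] and the star of [v], and [L = A n link v]; the
    vertices that are not in [A] form [T], and can all be pushed onto [v]. *)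
Section ConeAttachment.
Context {R : realType} {V : choiceType} (K A L : fscomplex V) (v w : V)
  (T : {fset V}).
Hypotheses (LA : forall s, faces L s -> faces A s)
  (AK : forall s, faces A s -> faces K s)
  (vT : v \in T) (AT : forall s u, faces A s -> u \in s -> u \notin T)
  (Lw : forall s, faces L s -> faces A (w |` s)%fset)
  (Lv : forall s, faces L s -> faces K (v |` s)%fset)
  (KA : forall s, faces K s -> (forall u, u \in s -> u \notin T) -> faces A s)
  (KL : forall s u, faces K s -> u \in s -> u \in T ->
     faces L (s `\` T)%fset /\ faces K (v |` s)%fset)
  (A_connected : forall s, faces A s -> (exists u, faces L [fset u]%fset) ->
     exists u, faces A (u |` s)%fset /\ faces A [fset u; w]%fset).

Let K0 := union_complex A (cone L v).

Let vA s : faces A s -> v \notin s.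
Proof. by move=> As; apply/negP => /(AT As); rewrite vT. Qed.

Let vL s : faces L s -> v \notin s.
Proof. by move=> /LA; exact: vA. Qed.

Let K0K s : faces K0 s -> faces K s.
Proof.
case=> [|/Lv]; first exact: AK.
move=> Ks; apply: subset_face Ks _; apply/fsubsetP => u us.
by rewrite !inE us andbT; case: (u == v).
Qed.

Definition push_fun (x : V -> R) : V -> R := fun u =>
  if u == v then \sum_(t <- T) x t else if u \in T then 0 else x u.

Lemma simplex_push s x : simplex s x -> simplex (v |` (s `\` T))%fset (push_fun x).
Proof.
move=> [x0 xs x1]; have vsT : v \notin (s `\` T)%fset by rewrite inE vT.
rewrite /push_fun; split=> [u|u|].
- by case: ifP => _; [rewrite sumr_ge0|case: ifP].
- rewrite !inE negb_or => /andP[/negbTE ->]; rewrite negb_and negbK.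
  by case: ifPn => //= uT; exact: xs.
- rewrite (big_fsetD1 v) ?fset1U1//= fsetU1K// eqxx.
  rewrite [X in _ + X](@eq_fbigr _ _ _ _ _ _ _ x); last first.
    move=> u us; have /fsetDP[us' uT] := us; rewrite (negbTE uT) ifN//.
    by apply: contraNneq uT => ->.
  rewrite -x1 [RHS](big_fsetID _ (mem T))/=; congr (_ + _).
    apply/esym/big_fset_incl => [|u uT].
      by apply/fsubsetP => u; rewrite !inE => /andP[].
    by rewrite !inE uT andbT; exact: xs.
  congr bigop; congr enum_fset; apply/fsetP => u; rewrite !inE.
  by rewrite andbC.
Qed.

Lemma push_id s x : simplex s x -> (forall u, u \in s -> u \in T -> u = v) ->
  push_fun x = x.
Proof.
move=> [_ xs _] sT; apply/funext => u; rewrite /push_fun.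
have xT t : t \in T -> t != v -> x t = 0.
  by move=> tT tv; apply: xs; apply: contra tv => /sT -> .
case: eqP => [->|/eqP uv]; last by case: ifPn => // uT; rewrite xT.
rewrite (big_fsetD1 v)//= big1_fset ?addr0// => t.
by rewrite !inE => /andP[tv tT] _; exact: xT.
Qed.

(** If [s] meets [T], adding [v] to it gives a face of [K] containing [x] and its image, and
    removing the rest of [T] gives a face of the cone. Otherwise [s] is a face of [A] and nothing
    moves. *)
Lemma push_face s x : faces K s -> simplex s x ->
  exists s', [/\ faces K0 s', simplex s' (push_fun x) &
    exists s'', [/\ faces K s'', simplex s'' x & simplex s'' (push_fun x)]].
Proof.
move=> Ks sx; have [[u us uT]|sT] := pselect (exists2 u, u \in s & u \in T).
  have [Ls Kvs] := KL Ks us uT.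
  have spx := simplex_push sx.
  exists (v |` (s `\` T))%fset; split=> //.
    by right; rewrite /=/cone_faces/= fsetU1K// inE vT.
  exists (v |` s)%fset; split=> //; first by apply: simplexS sx; exact: fsubsetU1.
  by apply: simplexS spx; apply: fsetUS; exact: fsubsetDl.
have sT' u : u \in s -> u \notin T.
  by move=> us; apply/negP => uT; apply: sT; exists u.
have px : push_fun x = x.
  by apply: push_id sx _ => u /sT' /negP.
rewrite px; exists s; split=> //; first by left; exact: KA.
by exists s.
Qed.

Lemma push_continuous (u : V) :
  continuous (fun x : realization R K => push_fun (coord x) u).
Proof.
rewrite /push_fun; case: (u == v).
  by apply: cts_sum => t; exact: coord_continuous.
by case: (u \in T); [exact: cts_cst|exact: coord_continuous].
Qed.

(** Only [v] is both in [T] and a vertex of [K0], so pushing fixes [K0]; on [K] it is joined to the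
    identity by segments. *)
Lemma homotopy_equivalent_cone (p : realization R A) :
  homotopy_equivalent R (realization R K) (realization R K0).
Proof.
have x0 : realization R K0 := inclusion (K' := K0) (fun s As => or_introl As) p.
pose push (x : realization R K) : realization R K0 := realpt x0 (push_fun (coord x)).
have pushE x : coord (push x) = push_fun (coord x).
  have [s Ks sx] := coord_simplex x; have [s' [K0s s'x _]] := push_face Ks sx.
  exact: (coord_realpt x0 K0s).
have cpush : continuous push.
  apply: realization_continuous => u.
  rewrite (_ : (fun _ => _) = fun x => push_fun (coord x) u).
    exact: push_continuous.
  by apply/funext => x; rewrite pushE.
pose incl : realization R K0 -> realization R K := inclusion K0K.
have cincl : continuous incl by exact: inclusion_continuous.
have inclE x : coord (incl x) = coord x by [].
exists push, incl; split=> //; apply: homotopic_onT; apply: homotopic_on_linear.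
- apply: continuous_subspaceT => x.
  by apply: continuous_comp; [exact: cpush|exact: cincl].
- by apply: continuous_subspaceT => x; exact: cvg_id.
- move=> x _ /=; have [s Ks sx] := coord_simplex x.
  have [s' [_ _ [s'' [Ks'' s''x s''p]]]] := push_face Ks sx.
  by exists s''; rewrite inclE pushE.
- apply: continuous_subspaceT => x.
  by apply: continuous_comp; [exact: cincl|exact: cpush].
- by apply: continuous_subspaceT => x; exact: cvg_id.
- move=> x _ /=; have [s K0s sx] := coord_simplex x.
  exists s; rewrite pushE inclE (push_id sx)//.
  move=> u us uT; case: K0s => [As|Cs].
    by have := AT As us; rewrite uT.
  apply/eqP/negPn/negP => uv; have := AT (LA Cs) _ ; move=> /(_ u).
  by rewrite !inE uv us uT => /(_ isT).
Qed.

Lemma cone_base_map_continuous (p : realization R A) :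
  {within [set z : realization R (cone L v) | cone_depth z = 1],
    continuous (cone_base_map p)}.
Proof.
apply: realization_continuous => u.
apply: (@within_continuous_eq _ _ _ (fun z => coord z u)).
  by move=> z zB; rewrite coord_cone_base_map.
by apply: continuous_subspaceT; exact: coord_continuous.
Qed.

Lemma homotopic_cst (T' : topologicalType) (U : choiceType) (M : fscomplex U)
    (B : set T') (x y : realization R M) s :
  faces M s -> simplex s (coord x) -> simplex s (coord y) ->
  homotopic_on (R := R) B (fun=> x) (fun=> y).
Proof.
move=> Ms sx sy; apply: homotopic_on_linear.
- exact: within_continuous_cst.
- exact: within_continuous_cst.
- by move=> t _; exists s.
Qed.

(** Inside [A], the cone on [L] with apex [w] contracts the inclusion to [w]. The constant map is
    then carried along an edge from [w] to [u] and a segment from [u] to [p], with [u] given by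
    [A_connected] for a face containing [p]. *)
Lemma cone_base_contractible (p : realization R A) :
  (exists u, faces L [fset u]%fset) ->
  homotopic_on (R := R) [set z : realization R (cone L v) | cone_depth z = 1]
    (cone_base_map p) (fun=> p).
Proof.
move=> Lne; have cB : closed [set z : realization R (cone L v) | cone_depth z = 1].
  apply: (closed_eq_fun (g := fun=> 1)); last exact: cts_cst.
  by apply: ctsB; [exact: cts_cst|exact: coord_continuous].
have [s As sp] := coord_simplex p.
have [u [Aus Auw]] := A_connected As Lne.
have [pw pwE] := coord_surj Auw (simplex_dirac (R := R) (fset22 u w)).
have [pu puE] := coord_surj Auw (simplex_dirac (R := R) (fset21 u w)).
apply: (homotopic_on_trans cB (g := fun=> pw)); last first.
  apply: (homotopic_on_trans cB (g := fun=> pu)).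
    apply: (homotopic_cst _ Auw); first by rewrite pwE; exact/simplex_dirac/fset22.
    by rewrite puE; exact/simplex_dirac/fset21.
  apply: (homotopic_cst _ Aus); first by rewrite puE; exact/simplex_dirac/fset1U1.
  by apply: simplexS sp; exact: fsubsetU1.
apply: homotopic_on_linear.
- exact: cone_base_map_continuous.
- exact: within_continuous_cst.
- move=> z zB; have [|l Ll lz] := @cone_base_simplex R V L v z.
    by move: zB; rewrite /= /cone_depth; lra.
  exists (w |` l)%fset; split; first exact: Lw.
    by rewrite coord_cone_base_map//; apply: simplexS lz; exact: fsubsetU1.
  by rewrite pwE; exact/simplex_dirac/fset1U1.
Qed.

(** The path runs from the pole to a vertex [u] of [L], then straight to [q']; [u] is taken in the
    face of [q'] if that face has a vertex in [L]. *)
Lemma suspension_connected (T' : topologicalType) (B : set T')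
    (q q' : realization R (suspension L)) : (exists u, faces L [fset u]%fset) ->
  closed B -> coord q = dirac_pt (inr true) ->
  homotopic_on (R := R) B (fun=> q) (fun=> q').
Proof.
move=> [u0 Lu0] cB qE; have [s [b [Ls sq']]] := suspension_coord q'.
have [u [Lu Lus]] : exists u, faces L [fset u]%fset /\ faces L (u |` s)%fset.
  have [s0|[u us]] := fset_0Vmem s; first by exists u0; rewrite s0 fsetU0.
  exists u; have -> : (u |` s)%fset = s by apply/fsetUidPr; rewrite fsub1set.
  by split=> //; apply: subset_face Ls _; rewrite fsub1set.
have f1 := suspension_face true Lu; have f2 := suspension_face b Lus.
have u1 : inl u \in join_face [fset u]%fset [fset true]%fset.
  by rewrite mem_join_inl inE.
have u2 : inl u \in join_face (u |` s)%fset [fset b]%fset.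
  by rewrite mem_join_inl fset1U1.
have [pu puE] := coord_surj f1 (simplex_dirac (R := R) u1).
apply: (homotopic_on_trans cB (g := fun=> pu)).
  apply: (homotopic_cst _ f1).
    by rewrite qE; apply: simplex_dirac; rewrite mem_join_inr inE.
  by rewrite puE; exact: simplex_dirac.
apply: (homotopic_cst _ f2); first by rewrite puE; exact: simplex_dirac.
apply: simplexS sq'; apply/fsubsetP => -[t|t]; rewrite ?mem_join_inl ?mem_join_inr//.
by move=> ts; rewrite inE ts orbT.
Qed.

Theorem cone_attachment_wedge (p : realization R A)
    (q : realization R (suspension L)) :
  homotopy_equivalent R (realization R K) (wedge2 p q).
Proof.
apply: (homotopy_equivalent_trans (homotopy_equivalent_cone p)).
have gl := glued_union LA vA p.
(* Without vertices in [L] the suspension is two points, so [q] is itself a pole and the cone can be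
   mapped with this pole as image of its base. The base is empty and the homotopy of attaching maps
   is vacuous. *)
have [Lne|L0] := pselect (exists u, faces L [fset u]%fset); last first.
  have L0' s : faces L s -> s = fset0.
    move=> Ls; have [//|[u us]] := fset_0Vmem s; case: L0; exists u.
    by apply: subset_face Ls _; rewrite fsub1set.
  have [s [b [/L0' -> sq]]] := suspension_coord q.
  have qE : coord q = dirac_pt (inr b).
    move/suspension_simplexP: sq; rewrite big_seq_fset0 add0r => -[_ q0 qb q1].
    apply/funext => -[u|b']; rewrite /dirac_pt; first by rewrite q0.
    rewrite (inj_eq (@inr_inj _ _)); case: eqP => [->//|b'b].
    by have -> : b' = ~~ b by case: (b) b' b'b => -[].
  apply: (glued_homotopy_equivalent (cone_collar L v) gl
    (glued_cone_suspension vL qE p)).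
  apply: homotopic_on_linear.
  - exact: cone_base_map_continuous.
  - exact: within_continuous_cst.
  - move=> z zB; have [|l /L0' -> lz] := @cone_base_simplex R V L v z.
      by move: zB; rewrite /= /cone_depth; lra.
    by have [u] := simplex_neq0 lz; rewrite inE.
(* The base is first crushed to the pole [inr true]; a path in the suspension and a collar of [p]
   then move the base point to [q]. *)
have f0 := suspension_face true (fset0_face L).
have t0 : inr true \in join_face (fset0 : {fset V}) [fset true]%fset.
  by rewrite mem_join_inr inE.
have [q' qE] := coord_surj f0 (simplex_dirac (R := R) t0).
apply: (homotopy_equivalent_trans (glued_homotopy_equivalent (cone_collar L v) gl
    (glued_cone_suspension vL qE p) (cone_base_contractible p Lne))).
have [m [e [me mp]]] := point_collar p.
apply: (wedge2_base_change _ _ _ _ me mp).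
- exact: realization_compact.
- exact: realization_compact.
- exact: realization_hausdorff.
- exact: realization_hausdorff.
- apply: suspension_connected => //.
  apply: accessible_closed_set1; apply: hausdorff_accessible.
  exact: realization_hausdorff.
Qed.

End ConeAttachment.

(** * Young complexes *)

Local Close Scope ring_scope.
Local Open Scope nat_scope.

(** The entry [h * t + i] lies in column [i], [h] rows above the bottom one;
    [mu] lists the row lengths from bottom to top. *)
Definition heights (mu : seq nat) (n : nat) (h : nat -> nat) : Prop :=
  (forall i, 1 <= i <= n -> h i < size mu /\ i <= nth 0 mu (h i)) /\
  (forall i, 1 <= i < n -> h i <= h i.+1).

Lemma entry_inj t h h' i i' : 1 <= i <= t -> 1 <= i' <= t ->
  h * t + i = h' * t + i' -> h = h' /\ i = i'.
Proof.
move=> it i't e; have t0 : 0 < t by lia.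
(* Columns run from 1 to [t]; without the predecessor, column [t] would be read one row too high. *)
have hE (k j : nat) : 1 <= j <= t -> (k * t + j).-1 %/ t = k.
  by case: j => // j /= jt; rewrite addnS /= divnMDl// divn_small ?addn0.
have hh : h = h' by rewrite -(hE h i it) -(hE h' i' i't) e.
by split=> //; move: e; rewrite hh => /addnI.
Qed.

Lemma heights_le mu n h i j : heights mu n h -> 1 <= i -> i <= j -> j <= n ->
  h i <= h j.
Proof.
move=> [_ hS] i1; elim: j => [|j IH] ij jn; first by lia.
have [->//|ij'] := eqVneq i j.+1.
by apply: (leq_trans (IH _ _) (hS _ _)); lia.
Qed.

(** Strict growth of entries is weak growth of heights: [h t + i < h' t + i + 1] amounts to
    [h <= h'] for positive [t]. *)
Lemma young_facesP t lam (s : {fset nat}) : 0 < t -> row_length lam 1 <= t ->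
  young_faces t lam s <-> exists h, heights (rev lam) (row_length lam 1) h /\
    forall x, x \in s -> exists2 i, 1 <= i <= row_length lam 1 & x = h i * t + i.
Proof.
set n := row_length lam 1 => t0 nt; split.
  move=> [a [sa sorta cola] sub]; pose h i := (nth 0 a i.-1 - i) %/ t.
  have colE i : 1 <= i <= n -> [/\ nth 0 a i.-1 = h i * t + i,
      h i < size lam & i <= nth 0 (rev lam) (h i)].
    move=> iN; have [j [jr /andP[_ ij] e]] := cola i iN.
    have hE : h i = size lam - j by rewrite /h e /box_entry addnK mulnK.
    rewrite hE; split=> //; first by lia.
    rewrite nth_rev; last by lia.
    have -> : size lam - (size lam - j).+1 = j.-1 by lia.
    exact: ij.
  exists h; split; last first.
    move=> x /sub /(nthP 0)[i]; rewrite sa => iN <-.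
    by exists i.+1; [lia|have [-> _ _] := colE i.+1 iN].
  split=> [i iN|i iN]; first by rewrite size_rev; have [] := colE i iN.
  have [e _ _] := colE i ltac:(lia); have [e' _ _] := colE i.+1 ltac:(lia).
  have : nth 0 a i.-1 < nth 0 a i.
    have := sortedP 0 sorta i.-1; rewrite sa prednK; last by lia.
    by apply; lia.
  rewrite e; move: e' => /= ->; nia.
move=> [h [hh sub]]; pose a := [seq h i * t + i | i <- iota 1 n].
have aE i : i < n -> nth 0 a i = h i.+1 * t + i.+1.
  by move=> iN; rewrite (nth_map 0) ?size_iota// nth_iota// add1n.
have sa : size a = n by rewrite size_map size_iota.
exists a; last first.
  by move=> x /sub[i iN ->]; apply/mapP; exists i => //; rewrite mem_iota; lia.
split=> //.
  apply/(sortedP 0) => i; rewrite sa => iN; rewrite !aE; try lia.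
  have := hh.2 i.+1 iN; nia.
move=> i iN; have [hi ih] := hh.1 i iN; rewrite size_rev in hi.
exists (size lam - h i); split.
- by lia.
- rewrite /row_length (_ : (size lam - h i).-1 = size lam - (h i).+1); last by lia.
  by move: ih; rewrite nth_rev// => ->; rewrite andbT; lia.
- rewrite aE; last by lia.
  by rewrite /box_entry subKn ?prednK; lia.
Qed.

Section YoungAttachment.
Variables (t n : nat) (lam : seq nat).
Hypotheses (n0 : 0 < n) (nt : n <= t).

Let lam1 := n :: n :: lam.
Let lam2 := n :: lam.
Let lam3 := [seq minn n.-1 l | l <- n :: lam].
(** As heights start at 0, this number of rows of [lam2] is the height of the top row of [lam1], and
    [r.-1] is that of the second row. *)
Let r := (size lam).+1.
Let mu := rev lam2.

Let t0 : 0 < t. Proof. by lia. Qed.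

Let size_mu : size mu = r. Proof. by rewrite size_rev. Qed.

Let rev_lam1 : rev lam1 = rcons mu n. Proof. by rewrite rev_cons. Qed.

Let mu_top : nth 0 mu r.-1 = n.
Proof. by rewrite nth_rev//= subnn. Qed.

Let K_faces s : faces (young_complex t lam1) s <->
  exists h, [/\ forall i, 1 <= i <= n ->
      h i <= r /\ (h i < r -> i <= nth 0 mu (h i)),
    forall i, 1 <= i < n -> h i <= h i.+1 &
    forall x, x \in s -> exists2 i, 1 <= i <= n & x = h i * t + i].
Proof.
rewrite /= young_facesP// /row_length/= /heights rev_lam1 size_rcons size_mu.
split=> -[h]; [move=> [[h1 h2] h3]|move=> [h1 h2 h3]]; exists h; split=> //.
  move=> i iN; have [hi ih] := h1 i iN; split; first by lia.
  by move=> hr; move: ih; rewrite nth_rcons size_mu hr.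
split=> // i iN; have [hi ih] := h1 i iN; split; first by lia.
rewrite nth_rcons size_mu; case: ltnP => [/ih//|rh].
by rewrite (_ : h i == r); lia.
Qed.

Let A_faces s : faces (young_complex t lam2) s <->
  exists h, [/\ forall i, 1 <= i <= n -> h i < r /\ i <= nth 0 mu (h i),
    forall i, 1 <= i < n -> h i <= h i.+1 &
    forall x, x \in s -> exists2 i, 1 <= i <= n & x = h i * t + i].
Proof.
rewrite /= young_facesP// /row_length/= /heights size_mu.
by split=> -[h]; [move=> [[h1 h2] h3]|move=> [h1 h2 h3]]; exists h.
Qed.

(** Capping the rows at [n.-1] only removes column [n]: for [i < n] the bounds [i <= minn n.-1 l]
    and [i <= l] agree, so [mu] still serves. *)
Let L_faces s : faces (young_complex t lam3) s <->
  exists h, [/\ forall i, 1 <= i < n -> h i < r /\ i <= nth 0 mu (h i),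
    forall i, 1 <= i < n.-1 -> h i <= h i.+1 &
    forall x, x \in s -> exists2 i, 1 <= i < n & x = h i * t + i].
Proof.
have n1 : row_length lam3 1 = n.-1 by rewrite /row_length/=; lia.
rewrite /= young_facesP// n1; last by lia.
have size3 : size (rev lam3) = r by rewrite size_rev size_map.
rewrite /heights size3 /lam3 -map_rev -/mu.
split=> -[h]; [move=> [[h1 h2] h3]|move=> [h1 h2 h3]]; exists h; split=> //.
- move=> i iN; have [|hi ih] := h1 i; first by lia.
  by split=> //; move: ih; rewrite (nth_map 0) ?size_mu//; lia.
- by move=> x /h3[i iN ->]; exists i => //; lia.
- split=> // i iN; have [|hi ih] := h1 i; first by lia.
  by split=> //; rewrite (nth_map 0) ?size_mu//; lia.
- by move=> x /h3[i iN ->]; exists i => //; lia.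
Qed.

Let T := [fset (r * t + i)%N | i in iota 1 n]%fset.
Let v := r * t + n.
Let w := r.-1 * t + n.

Let mem_T x : x \in T <-> exists2 i, 1 <= i <= n & x = r * t + i.
Proof.
split=> [/imfsetP[i /=]|[i iN ->]].
  by rewrite mem_iota => iN ->; exists i => //; lia.
by apply/imfsetP; exists i => //=; rewrite mem_iota; lia.
Qed.

Let entry_T h i : 1 <= i <= n -> (h * t + i \in T) <-> h = r.
Proof.
move=> iN; rewrite mem_T; split=> [[i' i'N /entry_inj[]]|->]; [lia|lia|by []|].
by exists i.
Qed.

Theorem young_wedge (R : realType) (p : realization R (young_complex t lam2))
    (q : realization R (suspension (young_complex t lam3))) :
  homotopy_equivalent R (realization R (young_complex t lam1)) (wedge2 p q).
Proof.
have r0 : 0 < r by [].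
have Lw s : faces (young_complex t lam3) s ->
    faces (young_complex t lam2) (w |` s)%fset.
  move=> /L_faces[h [h1 h2 h3]]; apply/A_faces.
  (* [r.-1] is the greatest height in [lam2], so it may follow any earlier heights, and its row
     reaches column [n]. *)
  exists (fun i => if i < n then h i else r.-1); split.
  - move=> i iN; case: (ltnP i n) => iN'; first by apply: h1; lia.
    by rewrite (_ : i = n) ?mu_top; lia.
  - move=> i iN; rewrite (_ : i < n); last by lia.
    case: (ltnP i.+1 n) => iN'; first by apply: h2; lia.
    by have [|] := h1 i; lia.
  - move=> x; rewrite inE => /orP[|/h3[i iN ->]].
      by rewrite inE => /eqP ->; exists n; rewrite ?ltnn//; lia.
    by exists i; [lia|rewrite ifT//; lia].
have Lv s : faces (young_complex t lam3) s ->
    faces (young_complex t lam1) (v |` s)%fset.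
  move=> /L_faces[h [h1 h2 h3]]; apply/K_faces.
  exists (fun i => if i < n then h i else r); split.
  - move=> i iN; case: (ltnP i n) => iN'; last by rewrite leqnn ltnn.
    by have [|? ?] := h1 i; [lia|split; lia].
  - move=> i iN; rewrite (_ : i < n); last by lia.
    case: (ltnP i.+1 n) => iN'; first by apply: h2; lia.
    by have [|] := h1 i; lia.
  - move=> x; rewrite inE => /orP[|/h3[i iN ->]].
      by rewrite inE => /eqP ->; exists n; rewrite ?ltnn//; lia.
    by exists i; [lia|rewrite ifT//; lia].
(* Row 1 can be lowered to row 2 because both have [n] boxes; heights below [r] do not change. *)
have lower_heights h : (forall i, 1 <= i <= n ->
      h i <= r /\ (h i < r -> i <= nth 0 mu (h i))) ->
    forall i, 1 <= i <= n ->
      minn (h i) r.-1 < r /\ i <= nth 0 mu (minn (h i) r.-1).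
  move=> h1 i iN; have [hi ih] := h1 i iN; split; first by lia.
  have [hr|hr] := ltnP (h i) r.
    have -> : minn (h i) r.-1 = h i by lia.
    exact: ih.
  have -> : minn (h i) r.-1 = r.-1 by lia.
  by rewrite mu_top; lia.
apply: (@cone_attachment_wedge R _ _ _ _ v w T).
- by move=> s /Lw As; apply: (subset_face As); exact: fsubsetU1.
- move=> s /A_faces[h [h1 h2 h3]]; apply/K_faces; exists h; split=> // i iN.
  by have [] := h1 i iN; split; lia.
- by apply/mem_T; exists n => //; lia.
- move=> s u /A_faces[h [h1 _ h3]] /h3[i iN ->]; apply/negP => /(entry_T _ iN).
  by have [] := h1 i iN; lia.
- exact: Lw.
- exact: Lv.
- move=> s /K_faces[h [h1 h2 h3]] sT; apply/A_faces.
  exists (fun i => minn (h i) r.-1); split; first exact: lower_heights.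
    by move=> i iN; have := h2 i iN; lia.
  move=> x xs; have := sT _ xs; have [i iN ->] := h3 x xs => /negP hT.
  exists i => //; congr (_ * t + _); have [hr _] := h1 i iN.
  have : h i <> r by move=> hi; apply/hT/entry_T.
  by lia.
- move=> s u /K_faces[h [h1 h2 h3]] us uT.
  (* Heights grow weakly, so one vertex in row 1 forces the last column into row 1, where the box is
     [v]. The rectangle [nseq r.+1 n] is a dummy shape that allows [heights_le] to be applied. *)
  have hn : h n = r.
    have [i iN ui] := h3 u us; move: uT; rewrite ui => /(entry_T _ iN) hi.
    have hh : heights (nseq r.+1 n) n h.
      split=> // j jN; have [hj _] := h1 j jN.
      by rewrite size_nseq nth_nseq ltnS hj; lia.
    have := heights_le hh (i := i) (j := n); have [] := h1 n; lia.
  split.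
    apply/L_faces; exists (fun i => minn (h i) r.-1); split.
    + by move=> i iN; apply: lower_heights => //; lia.
    + by move=> i iN; have := h2 i; lia.
    (* A vertex outside [T] is not in column [n], because that column has height [r]. *)
    + move=> x /fsetDP[xs]; have [i iN ->] := h3 x xs => /negP hT.
      have hr : h i <> r by move=> hi; apply/hT/entry_T.
      have [hi _] := h1 i iN.
      exists i; last by congr (_ * t + _); lia.
      by have : i <> n by [move=> ni; apply: hr; rewrite ni]; lia.
  apply/K_faces; exists h; split=> // x; rewrite inE => /orP[|/h3//].
  by rewrite inE => /eqP ->; exists n; rewrite ?hn//; lia.
- move=> s /A_faces[h [h1 h2 h3]] [u /L_faces[g [_ _ g3]]].
  (* A vertex of [L] makes columns 1 and [n] distinct. The new [u] is the box in column 1 of a facet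
     through [s]; continuing it at the top height [r.-1] in all other columns gives a facet through
     [u] and [w]. *)
  have n2 : 1 < n by have [|i iN _] := g3 u; [rewrite inE|lia].
  have [hr1 _] := h1 1 ltac:(lia).
  exists (h 1 * t + 1); split.
    apply/A_faces; exists h; split=> // x; rewrite inE => /orP[|/h3//].
    by rewrite inE => /eqP ->; exists 1 => //; lia.
  apply/A_faces; exists (fun i => if i == 1 then h 1 else r.-1); split.
  + move=> i iN; case: eqP => [->|_]; first by apply: h1; lia.
    by rewrite mu_top; lia.
  + move=> i iN; have -> : (i.+1 == 1) = false by case: i iN.
    by case: (i == 1); lia.
  + move=> x; rewrite !inE => /orP[] /eqP ->; first by exists 1 => //; lia.
    by exists n; [lia|rewrite ifF//; lia].
Qed.

End YoungAttachment.

Theorem lemma2p3 (R : realType) (t : nat) (lam : seq nat)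
  (t_gt0 : 0 < t) (lam_part : is_partition lam) (lam_rows : 2 <= size lam)
  (lam12 : row_length lam 1 = row_length lam 2) (lam1t : row_length lam 1 <= t) :
  let lam' := behead lam in
  let lam'' := [seq minn (row_length lam 1).-1 l | l <- behead lam] in
  forall (p : realization R (young_complex t lam'))
         (q : realization R (suspension (young_complex t lam''))),
    homotopy_equivalent R (realization R (young_complex t lam)) (wedge2 p q).
Proof.
case: lam lam_part lam_rows lam12 lam1t => [//|n [//|m lam]] [_ /andP[n0 _]] _.
rewrite /row_length /= => nm nt; rewrite -{m}nm; exact: young_wedge.
Qed.
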